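(* Let $\beta\in\mathbf{C}$ with $0<|\beta|<1$, and let $A=T_{1+\beta z}^{-1}T_{\frac{z+\overline z}{2}}T_{1+\beta z}$, an operator on the Hardy space $H^2$. Then $$\max\left\{\frac{\left|\beta-\overline\beta(1-|\beta|^2)\right|}{2\sqrt{1-|\beta|^2}},\ \frac{\sqrt{1-|\beta|^2}}{8}\left|\frac{2+\overline\beta^2}{1-|\beta|^2}-2\overline\beta-\overline\beta^3\right|\right\}\le M(A)\le\frac{1+|\beta|}{1-|\beta|}$$ and $$\max\left\{1,\sqrt{\frac{M(A)}{2e}}\right\}\le P(A)\le\frac{1+|\beta|}{1-|\beta|}.$$
   Context: $H^2$ is the Hardy space of the unit circle $\partial\mathbf{D}$: the closed linear span in $L^2(\partial\mathbf{D},\theta)$ ($d\theta$ being normalized arc length measure) of $\{z^n : n=0,1,2,\dots\}$, where $z(e^{it})=e^{it}$. For $f\in L^\infty(\partial\mathbf{D},\theta)$ the Toeplitz operator $T_f$ on $H^2$ is $T_fh=\mathcal{P}(fh)$, where $\mathcal{P}$ is the orthogonal projection of $L^2(\partial\mathbf{D},\theta)$ onto $H^2$. For a bounded operator $A$ with spectrum $\sigma(A)$ contained in the closed unit disk $\overline{\mathbf{D}}$, set $M(A)=\sup_{n\ge 0}\|A^n\|$ (over integers $n\geq 0$, with $A^0=I$) and $P(A)=\sup_{|\lambda|>1}\mathrm{dist}(\lambda,\sigma(A))\,\|(\lambda I-A)^{-1}\|$, norms being operator norms. Here $e$ is Euler's number. *)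

(* Defs.v *)
From HB Require Import structures.
From mathcomp Require Import all_boot all_order all_algebra.
From mathcomp Require Import complex.
From mathcomp Require Import all_classical all_reals all_analysis measurable_realfun ess_sup_inf.

Set Implicit Arguments.
Unset Strict Implicit.
Unset Printing Implicit Defensive.
Import Order.TTheory GRing.Theory Num.Def Num.Theory.
Import numFieldNormedType.Exports ComplexField.Normc.

Local Open Scope classical_set_scope.
Local Open Scope ring_scope.
Local Open Scope complex_scope.
Local Open Scope quotient_scope.

Section complex_L2_functions.
Context d (T : measurableType d) (R : realType).
Variable mu : {measure set T -> \bar R}.
Local Notation C := R[i].
Implicit Types f g : T -> C.

Definition cmeasurable f :=
  measurable_fun setT (fun t => complex.Re (f t)) /\
  measurable_fun setT (fun t => complex.Im (f t)).

Definition L2pred : {pred T -> C} := fun f =>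
  `[< cmeasurable f /\ finite_norm mu 2%:E (fun t => normc (f t)) >].

Definition Linfty f :=
  cmeasurable f /\ finite_norm mu +oo%E (fun t => normc (f t)).

Lemma normcE (z : C) :
  normc z = Num.sqrt (complex.Re z ^+ 2 + complex.Im z ^+ 2).
Proof. by case: z. Qed.

Lemma normc_ge0 (z : C) : 0 <= normc z.
Proof. by rewrite normcE sqrtr_ge0. Qed.

Lemma normr_normc (z : C) : `|z| = (normc z)%:C.
Proof. by rewrite normc_def normcE. Qed.

Lemma ReD (z w : C) : complex.Re (z + w) = complex.Re z + complex.Re w.
Proof. by case: z; case: w. Qed.

Lemma ImD (z w : C) : complex.Im (z + w) = complex.Im z + complex.Im w.
Proof. by case: z; case: w. Qed.

Lemma ReM (z w : C) : complex.Re (z * w) =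
  complex.Re z * complex.Re w - complex.Im z * complex.Im w.
Proof. by case: z; case: w. Qed.

Lemma ImM (z w : C) : complex.Im (z * w) =
  complex.Re z * complex.Im w + complex.Im z * complex.Re w.
Proof. by case: z => a b; case: w. Qed.

Lemma cmeasurable_cst (c : C) : cmeasurable (fun=> c).
Proof. by split; exact: measurable_cst. Qed.

Lemma cmeasurableD f g :
  cmeasurable f -> cmeasurable g -> cmeasurable (fun t => f t + g t).
Proof.
move=> [f1 f2] [g1 g2]; split.
  by under eq_fun do rewrite ReD; exact: measurable_funD.
by under eq_fun do rewrite ImD; exact: measurable_funD.
Qed.

Lemma cmeasurableM f g :
  cmeasurable f -> cmeasurable g -> cmeasurable (fun t => f t * g t).
Proof.
move=> [f1 f2] [g1 g2]; split.
  under eq_fun do rewrite ReM.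
  by apply: measurable_funB; exact: measurable_funM.
under eq_fun do rewrite ImM.
by apply: measurable_funD; exact: measurable_funM.
Qed.

Lemma measurable_normc f :
  cmeasurable f -> measurable_fun setT (fun t => normc (f t)).
Proof.
move=> [f1 f2]; under eq_fun do rewrite normcE -powR12_sqrt ?addr_ge0 ?sqr_ge0//.
apply: (@measurableT_comp _ _ _ _ _ _ (fun x : R => x `^ 2^-1)) => //.
by apply: measurable_funD; exact: measurable_funX.
Qed.


Lemma le_Lnorm2 (u v : T -> R) :
  measurable_fun setT u -> measurable_fun setT v ->
  {ae mu, forall t, `|u t| <= `|v t|} ->
  (Lnorm mu 2%:E (EFin \o u) <= Lnorm mu 2%:E (EFin \o v))%E.
Proof.
move=> mu_ mv uv; rewrite unlock.
have m2 (w : T -> R) : measurable_fun setT w ->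
    measurable_fun setT (fun t => (`|(w t)%:E| `^ 2)%E).
  move=> mw; apply: (@measurableT_comp _ _ _ _ _ _ (fun x => poweR x 2)) => //.
    exact: measurable_poweR.
  by apply: measurableT_comp => //; exact: measurableT_comp.
rewrite gt0_ler_poweR//.
- by rewrite in_itv/= leey andbT; apply: integral_ge0 => t _; rewrite lee_fin powR_ge0.
- by rewrite in_itv/= leey andbT; apply: integral_ge0 => t _; rewrite lee_fin powR_ge0.
- apply: ae_ge0_le_integral => //.
  + by move=> t _; exact: poweR_ge0.
  + exact: m2.
  + by move=> t _; exact: poweR_ge0.
  + exact: m2.
  + apply: filterS uv => t uvt _ /=.
    rewrite lee_fin.
    by apply: ge0_ler_powR => //; rewrite nnegrE.
Qed.

(* (\int |f|^2)^(1/2): the library's real Lebesgue norm applied to |f|. *)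
Definition L2norm f : R := fine (Lnorm mu 2%:E (EFin \o (fun t => normc (f t)))).

Lemma L2normE f : f \in L2pred ->
  (L2norm f)%:E = Lnorm mu 2%:E (EFin \o (fun t => normc (f t))).
Proof.
move=> /asboolP[_ ff]; rewrite fineK// ge0_fin_numE//.
exact: Lnorm_ge0.
Qed.

Lemma L2pred_cmeas f : f \in L2pred -> cmeasurable f.
Proof. by move=> /asboolP[]. Qed.

Lemma Lfun_normc f : f \in L2pred -> (fun t => normc (f t)) \in Lfun mu 2%:E.
Proof.
move=> /asboolP[mf ff]; apply/andP; split; rewrite inE//.
exact: measurable_normc.
Qed.

Lemma Lnorm2Z f (k : R) : f \in L2pred -> 0 <= k ->
  Lnorm mu 2%:E (EFin \o (fun t => k * normc (f t))) = (k * L2norm f)%:E.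
Proof.
move=> fL k0; have nf := Lfun_normc fL.
have := @LnormZ _ _ _ mu 2%:E (lee1n 2) (Lfun_Sub (lee1n 2) nf) k.
rewrite (_ : EFin \o k \*: (Lfun_Sub (lee1n 2) nf : T -> R) =
  EFin \o (fun t => k * normc (f t)))// => ->.
by rewrite ger0_norm// EFinM L2normE.
Qed.

Lemma Linfty_bounded f (K : R) :
  cmeasurable f -> (forall t, normc (f t) <= K) -> Linfty f.
Proof.
move=> mf fK; split=> //; rewrite /finite_norm unlock; case: ifPn => // _.
apply: (@le_lt_trans _ _ K%:E); last exact: ltry.
by apply/ess_supP/nearW => t /=; rewrite lee_fin ger0_norm ?normc_ge0.
Qed.

Lemma Linfty_mul f g : Linfty f -> g \in L2pred -> (fun t => f t * g t) \in L2pred.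
Proof.
move=> [mf ff] gL; have mg := L2pred_cmeas gL.
have [K [K0 fK]] : exists K : R, 0 <= K /\ {ae mu, forall t, normc (f t) <= K}.
  have [muT|muT] := ltP 0%E (mu setT); last first.
    exists 0; split=> //; apply: (@negligibleS _ _ _ mu setT) => //.
    exists setT; split => //; apply/eqP; rewrite eq_le muT/=.
    exact: measure_ge0.
  move: ff; rewrite /finite_norm unlock muT => /ess_supr_bounded[K fK].
  exists (maxr 0 K); split; first by rewrite le_max lexx.
  apply: filterS fK => t /=; rewrite ger0_norm ?normc_ge0// => /le_trans; apply.
  by rewrite le_max lexx orbT.
apply/asboolP; split; first exact: cmeasurableM.
rewrite /finite_norm.
apply: (@le_lt_trans _ _ (K * L2norm g)%:E); last exact: ltry.
rewrite -Lnorm2Z//; apply: le_Lnorm2.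
- by apply: measurable_normc; exact: cmeasurableM.
- by apply: measurable_funM => //; exact: measurable_normc.
- apply: filterS fK => t ft.
  rewrite normcM !ger0_norm ?mulr_ge0 ?normc_ge0//.
  by rewrite ler_wpM2r ?normc_ge0.
Qed.

Lemma L2pred_submod_closed : submod_closed L2pred.
Proof.
split.
  apply/asboolP; split; first exact: cmeasurable_cst.
  rewrite /finite_norm; under eq_fun do rewrite normc0.
  by rewrite Lnorm0.
move=> a f g fL gL; have mf := L2pred_cmeas fL; have mg := L2pred_cmeas gL.
have maf : cmeasurable (fun t => a * f t).
  by apply: cmeasurableM => //; exact: cmeasurable_cst.
apply/asboolP; split; first exact: cmeasurableD.
rewrite /finite_norm.
have mn := measurable_normc.
apply: (@le_lt_trans _ _ (Lnorm mu 2%:E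
  (EFin \o (((fun t => normc a * normc (f t)) \+ (fun t => normc (g t))))))).
  apply: le_Lnorm2.
  - by apply: mn; exact: cmeasurableD.
  - by apply: measurable_funD; [apply: measurable_funM|] => //; exact: mn.
  - apply/nearW => t /=; rewrite !ger0_norm ?addr_ge0 ?mulr_ge0 ?normc_ge0//.
    by rewrite -normcM; exact: le_normcD.
apply: le_lt_trans (minkowski_EFin _ _ _ _) _ => //.
- by apply: measurable_funM => //; exact: mn.
- exact: mn.
- by rewrite ler1n.
- by rewrite Lnorm2Z ?normc_ge0// -L2normE// -EFinD ltry.
Qed.

HB.instance Definition _ :=
  GRing.isSubmodClosed.Build C (T -> C) L2pred L2pred_submod_closed.

Record L2fun := MkL2fun { L2fun_val : T -> C ; _ : L2fun_val \in L2pred }.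
HB.instance Definition _ := [isSub for L2fun_val].
HB.instance Definition _ := [Choice of L2fun by <:].
HB.instance Definition _ := [SubChoice_isSubLmodule of L2fun by <:].

End complex_L2_functions.

Section complex_L2_space.
Context d (T : measurableType d) (R : realType).
Variable mu : {measure set T -> \bar R}.
Local Notation C := R[i].
Local Notation L2fun := (L2fun mu).
Implicit Types f g h : L2fun.

Definition L2eq f g := `[< {ae mu, forall t, L2fun_val f t = L2fun_val g t} >].

Let L2eq_refl : reflexive L2eq.
Proof. by move=> f; apply/asboolP/nearW. Qed.

Let L2eq_sym : symmetric L2eq.
Proof.
by move=> f g; apply/asboolP/asboolP; apply: filterS => t ->.
Qed.

Let L2eq_trans : transitive L2eq.
Proof.
move=> g f h /asboolP fg /asboolP gh; apply/asboolP.
by apply: filterS2 fg gh => t -> ->.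
Qed.

Canonical L2eq_equiv := EquivRel L2eq L2eq_refl L2eq_sym L2eq_trans.

(* L^2(mu) over the complex field: square-integrable functions modulo
   equality mu-almost everywhere. *)
Definition L2 : Type := {eq_quot L2eq}.
HB.instance Definition _ := Choice.on L2.
HB.instance Definition _ := EqQuotient.on L2.

Lemma L2P f g : reflect {ae mu, forall t, L2fun_val f t = L2fun_val g t}
  (\pi_L2 f == \pi_L2 g).
Proof. by rewrite eqmodE; exact: asboolP. Qed.

Lemma L2_repr f :
  {ae mu, forall t, L2fun_val (repr (\pi_L2 f)) t = L2fun_val f t}.
Proof. by apply/L2P; rewrite reprK. Qed.

Lemma L2W (P : L2 -> Prop) : (forall f, P (\pi_L2 f)) -> forall x, P x.
Proof. by move=> Pf x; rewrite -[x]reprK. Qed.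

Implicit Types x y z : L2.

Definition L2zero : L2 := \pi_L2 0.
Definition L2opp x : L2 := \pi_L2 (- repr x).
Definition L2add x y : L2 := \pi_L2 (repr x + repr y).
Definition L2scale (c : C) x : L2 := \pi_L2 (c *: repr x).

Lemma L2fun_valN f t : L2fun_val (- f) t = - L2fun_val f t.
Proof. by []. Qed.

Lemma L2fun_valD f g t : L2fun_val (f + g) t = L2fun_val f t + L2fun_val g t.
Proof. by []. Qed.

Lemma L2fun_valZ (c : C) f t : L2fun_val (c *: f) t = c * L2fun_val f t.
Proof. by []. Qed.

Let piN f : L2opp (\pi_L2 f) = \pi_L2 (- f).
Proof. by apply/eqP/L2P; apply: filterS (L2_repr f) => t e; rewrite !L2fun_valN e. Qed.

Let piD f g : L2add (\pi_L2 f) (\pi_L2 g) = \pi_L2 (f + g).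
Proof.
apply/eqP/L2P; apply: filterS2 (L2_repr f) (L2_repr g) => t ef eg.
by rewrite !L2fun_valD ef eg.
Qed.

Let piZ c f : L2scale c (\pi_L2 f) = \pi_L2 (c *: f).
Proof.
apply/eqP/L2P; apply: filterS (L2_repr f) => t ef.
by rewrite !L2fun_valZ ef.
Qed.

Let addA : associative L2add.
Proof.
move=> x y z; elim/L2W: x => f; elim/L2W: y => g; elim/L2W: z => h.
by rewrite !piD addrA.
Qed.

Let addC : commutative L2add.
Proof. by move=> x y; elim/L2W: x => f; elim/L2W: y => g; rewrite !piD addrC. Qed.

Let add0 : left_id L2zero L2add.
Proof. by move=> x; elim/L2W: x => f; rewrite !piD add0r. Qed.

Let addN : left_inverse L2zero L2opp L2add.
Proof. by move=> x; elim/L2W: x => f; rewrite piN piD addNr. Qed.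

HB.instance Definition _ := GRing.isZmodule.Build L2 addA addC add0 addN.

Let scaleA (a b : C) x : L2scale a (L2scale b x) = L2scale (a * b) x.
Proof. by elim/L2W: x => f; rewrite !piZ scalerA. Qed.

Let scale1 : left_id 1 L2scale.
Proof. by move=> x; elim/L2W: x => f; rewrite piZ scale1r. Qed.

Let scaleDr : right_distributive L2scale +%R.
Proof.
move=> c x y; elim/L2W: x => f; elim/L2W: y => g.
by rewrite [_ + _]piD !piZ [RHS]piD scalerDr.
Qed.

Let scaleDl x : {morph L2scale^~ x : a b / a + b}.
Proof.
by move=> a b; elim/L2W: x => f; rewrite !piZ [RHS]piD scalerDl.
Qed.

HB.instance Definition _ :=
  GRing.Zmodule_isLmodule.Build C L2 scaleA scale1 scaleDr scaleDl.

Lemma L2_piD f g : \pi_L2 (f + g) = \pi_L2 f + \pi_L2 g.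
Proof. by rewrite [RHS]piD. Qed.

Lemma L2_piZ (c : C) f : \pi_L2 (c *: f) = c *: \pi_L2 f.
Proof. by rewrite [RHS]piZ. Qed.

Lemma L2norm_ae f g : {ae mu, forall t, L2fun_val f t = L2fun_val g t} ->
  L2norm mu (L2fun_val f) = L2norm mu (L2fun_val g).
Proof.
move=> fg; have mf := measurable_normc (L2pred_cmeas (valP f)).
have mg := measurable_normc (L2pred_cmeas (valP g)).
rewrite /L2norm; congr fine; apply/eqP; rewrite eq_le; apply/andP; split;
  by apply: le_Lnorm2 => //; apply: filterS fg => t ->.
Qed.

Definition L2nrm x : C := (L2norm mu (L2fun_val (repr x)))%:C.

Let nrm_pi f : L2nrm (\pi_L2 f) = (L2norm mu (L2fun_val f))%:C.
Proof. by congr (_%:C); apply/L2norm_ae/L2_repr. Qed.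

Let ler_nrmD x y : L2nrm (x + y) <= L2nrm x + L2nrm y.
Proof.
elim/L2W: x => f; elim/L2W: y => g.
rewrite -L2_piD !nrm_pi -raddfD/= lecR -lee_fin EFinD.
rewrite !L2normE ?(rpredD (valP f) (valP g)) ?(valP f) ?(valP g)//.
have mn (h : L2fun) := measurable_normc (L2pred_cmeas (valP h)).
apply: le_trans _ (minkowski_EFin mu (mn f) (mn g) (ler1n R 2)).
apply: le_Lnorm2; [exact: (mn (f + g))|exact: measurable_funD|].
apply/nearW => t /=; rewrite !ger0_norm ?addr_ge0 ?normc_ge0//.
exact: le_normcD.
Qed.

Let nrmZ (c : C) x : L2nrm (c *: x) = `|c| * L2nrm x.
Proof.
elim/L2W: x => f; rewrite -L2_piZ !nrm_pi normr_normc -rmorphM/=.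
congr (_%:C); apply: EFin_inj; rewrite (L2normE (valP (c *: f))).
rewrite -(Lnorm2Z (valP f)) ?normc_ge0//; congr Lnorm.
by apply/funext => t /=; rewrite -normcM.
Qed.

Let nrm0_eq0 x : L2nrm x = 0 -> x = 0.
Proof.
elim/L2W: x => f; rewrite nrm_pi.
move=> /(congr1 (@complex.Re R))/= n0.
have := congr1 EFin n0; rewrite (L2normE (valP f)).
have mf := measurable_normc (L2pred_cmeas (valP f)).
move=> nf0; have p0 : (0 < 2%:E :> \bar R)%E by rewrite lte_fin.
have /measurable_EFinP mEf := mf.
have h := Lnorm_eq0_eq0 mEf p0 nf0.
by apply/eqP/L2P; apply: filterS h => t /(_ Logic.I)/= [/eq0_normc].
Qed.

HB.instance Definition _ :=
  Lmodule_isNormed.Build C L2 ler_nrmD nrmZ nrm0_eq0.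

Definition L2inner x y : C :=
  let w t := L2fun_val (repr x) t * (L2fun_val (repr y) t)^* in
  (\int[mu]_t complex.Re (w t)) +i* (\int[mu]_t complex.Im (w t)).

(* Total in f: when f is not essentially bounded and the product is not
   square integrable, [insubd] returns 0. For f in L^oo see [L2mulE]. *)
Definition L2mul (f : T -> C) x : L2 :=
  \pi_L2 (insubd 0 (fun t => f t * L2fun_val (repr x) t)).

Lemma L2mulE (f : T -> C) (g : L2fun) (fL : Linfty mu f) :
  L2mul f (\pi_L2 g) = \pi_L2 (MkL2fun (Linfty_mul fL (valP g))).
Proof.
have := L2_repr g; rewrite /L2mul; set r := repr _ => rg.
apply/eqP/L2P; rewrite -[L2fun_val (insubd _ _)]/(val (insubd _ _)).
rewrite val_insubd ifT; last exact: (Linfty_mul fL (valP r)).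
by apply: filterS rg => t /= ->.
Qed.

End complex_L2_space.

Section bounded_operators.
Context (R : realType) (V : normedModType R[i]).
Local Notation C := R[i].
Implicit Types (A B : V -> V) (l : C).

(* The norm of a normed module over R[i] takes (real, nonnegative) values in
   R[i]; [rnorm] is the same number in R. *)
Definition rnorm (x : V) : R := complex.Re `|x|.

Definition bounded_operator A :=
  linear A /\ exists K : R, forall x, rnorm (A x) <= K * rnorm x.

(* Valued in \bar R, so that the suprema below need no boundedness proof. *)
Definition opnorm A : \bar R :=
  ereal_sup [set (rnorm (A x))%:E | x in [set x | rnorm x <= 1]].

Definition bounded_inverse A B :=
  [/\ bounded_operator B, cancel A B & cancel B A].

(* The inverse in the algebra of bounded operators; the constant 0 if A is
   not invertible there. *)
Definition opinv A : V -> V := xget (fun=> 0) [set B | bounded_inverse A B].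

Definition shift_op l A : V -> V := fun x => l *: x - A x.

Definition spectrum A : set C :=
  [set l | ~ exists B, bounded_inverse (shift_op l A) B].

Definition dist_to (l : C) (S : set C) : \bar R :=
  ereal_inf [set (normc (l - m))%:E | m in S].

(* M(A) *)
Definition power_bound A : \bar R :=
  ereal_sup [set opnorm (iter n A) | n in [set: nat]].

(* P(A). It is meaningful when the spectrum lies in the closed unit disk,
   so that every resolvent in the supremum exists. *)
Definition resolvent_bound A : \bar R :=
  ereal_sup [set (dist_to l (spectrum A) * opnorm (opinv (shift_op l A)))%E
            | l in [set l | 1 < normc l]].

End bounded_operators.

Section Hardy_space.
Context (R : realType).
Local Notation C := R[i].

Lemma twopi_gt0 : 0 < 2 * pi :> R.
Proof. by rewrite mulr_gt0 ?pi_gt0. Qed.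

(* The unit circle is parametrized by t in [0, 2 pi], so a function f on the
   circle is represented by t |-> f(e^{it}) and normalized arc length is the
   uniform probability on [0, 2 pi] (the rest of the line is a null set). *)
Definition theta := uniform_prob twopi_gt0.
Local Notation L2T := (L2 theta).

(* The coordinate function z(e^{it}) = e^{it}. *)
Definition zc (t : measurableTypeR R) : C := cos t +i* sin t.

Lemma normc_zc t : normc (zc t) = 1.
Proof. by rewrite normcE/= cos2Dsin2 sqrtr1. Qed.

Lemma cmeasurable_zc : cmeasurable zc.
Proof.
by split; apply: continuous_measurable_fun;
  [exact: continuous_cos|exact: continuous_sin].
Qed.

Lemma zcX_L2 n : (fun t => zc t ^+ n) \in L2pred theta.
Proof.
apply/asboolP; split.
  elim: n => [|n IH]; first exact: cmeasurable_cst.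
  under eq_fun do rewrite exprS.
  exact: cmeasurableM cmeasurable_zc IH.
have -> : (fun t => normc (zc t ^+ n)) = cst 1.
  apply/funext => t /=; elim: n => [|n IH]; first by rewrite expr0 normc1.
  by rewrite exprS normcM IH normc_zc mulr1.
have := Lfun_cst theta 1 2.
by rewrite inE => /andP[_]; rewrite inE.
Qed.

Definition zpow n : L2T := \pi_L2T (MkL2fun (zcX_L2 n)).

Definition zspan : set L2T :=
  [set x | exists n (c : nat -> C), x = \sum_(k < n) c k *: zpow k].

Definition H2pred : {pred L2T} := fun x => `[< closure zspan x >].

Lemma zspan_linear (a : C) x y : zspan x -> zspan y -> zspan (a *: x + y).
Proof.
have pad m p (c : nat -> C) : (m <= p)%N -> \sum_(k < m) c k *: zpow k =
    \sum_(k < p) (if (k < m)%N then c k else 0) *: zpow k.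
  move=> mp; rewrite (big_ord_widen _ (fun k => c k *: zpow k) mp) big_mkcond/=.
  by apply: eq_bigr => k _; case: ifP => // _; rewrite scale0r.
move=> [m [c ->]] [n [e ->]].
rewrite (pad m (maxn m n)) ?leq_maxl// (pad n (maxn m n)) ?leq_maxr//.
eexists; exists (fun k => a * (if (k < m)%N then c k else 0) +
                     if (k < n)%N then e k else 0).
rewrite scaler_sumr -big_split/=; apply: eq_bigr => k _.
by rewrite scalerA -scalerDl.
Qed.

Lemma H2pred_submod_closed : submod_closed H2pred.
Proof.
split.
  apply/asboolP/subset_closure; exists 0%N, (fun=> 0).
  by rewrite big_ord0.
move=> a x y /asboolP cx /asboolP cy; apply/asboolP => B Bxy.
have cts : (a *: p.1 + p.2 : L2T) @[p --> (x, y)] --> a *: x + y.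
  apply: cvgD; last exact: cvg_snd.
  by apply: cvgZr; exact: cvg_fst.
have /= [[B1 B2]/= [B1x B2y] B12] := cts B Bxy.
have [u [zu Bu]] := cx B1 B1x; have [v [zv Bv]] := cy B2 B2y.
exists (a *: u + v); split; first exact: zspan_linear.
exact: (B12 (u, v)).
Qed.

HB.instance Definition _ :=
  GRing.isSubmodClosed.Build C L2T H2pred H2pred_submod_closed.

Record H2 := MkH2 { H2_val : L2T ; _ : H2_val \in H2pred }.
HB.instance Definition _ := [isSub for H2_val].
HB.instance Definition _ := [Choice of H2 by <:].
HB.instance Definition _ := [SubChoice_isSubLmodule of H2 by <:].

Let H2nrm (x : H2) : C := `|H2_val x|.

Let ler_H2nrmD (x y : H2) : H2nrm (x + y) <= H2nrm x + H2nrm y.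
Proof. exact: ler_normD. Qed.

Let H2nrmZ (c : C) (x : H2) : H2nrm (c *: x) = `|c| * H2nrm x.
Proof. exact: normrZ. Qed.

Let H2nrm0_eq0 (x : H2) : H2nrm x = 0 -> x = 0.
Proof. by move=> /normr0_eq0 x0; apply/val_inj. Qed.

HB.instance Definition _ :=
  Lmodule_isNormed.Build C H2 ler_H2nrmD H2nrmZ H2nrm0_eq0.

(* The orthogonal projection of L^2 onto H^2: the element h of H^2 such that
   x - h is orthogonal to H^2. *)
Definition H2proj (x : L2T) : H2 :=
  xget 0 [set h | forall k : H2, L2inner (x - H2_val h) (H2_val k) = 0].

Definition toeplitz (f : measurableTypeR R -> C) (h : H2) : H2 := H2proj (L2mul f (H2_val h)).

Lemma Linfty_1DbZ (b : C) : Linfty theta (fun t => 1 + b * zc t).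
Proof.
apply: (@Linfty_bounded _ _ _ _ _ (1 + normc b)).
  apply: cmeasurableD; first exact: cmeasurable_cst.
  by apply: cmeasurableM; [exact: cmeasurable_cst|exact: cmeasurable_zc].
move=> t; apply: le_trans (le_normcD _ _) _.
by rewrite normc1 normcM normc_zc mulr1.
Qed.

Lemma Linfty_Rez : Linfty theta (fun t => (zc t + (zc t)^*) / 2).
Proof.
apply: (@Linfty_bounded _ _ _ _ _ 1).
  apply: cmeasurableM; last exact: cmeasurable_cst.
  apply: cmeasurableD; first exact: cmeasurable_zc.
  case: cmeasurable_zc => mc ms; split => //.
  exact: measurable_funN ms.
have n2 : normc (2 : C) = 2.
  have -> : (2 : C) = (2 : R)%:C by rewrite rmorph_nat.
  by rewrite normcE/= expr0n/= addr0 sqrtr_sqr ger0_norm.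
have nJ (z : C) : normc z^* = normc z by rewrite !normcE; case: z => x y/=; rewrite sqrrN.
move=> t; rewrite normcM normcV n2 ler_pdivrMr// mul1r.
by apply: le_trans (le_normcD _ _) _; rewrite nJ normc_zc.
Qed.

End Hardy_space.

(* Main.v *)
Require Import Defs.
From HB Require Import structures.
From mathcomp Require Import all_boot all_order all_algebra.
From mathcomp Require Import complex.
From mathcomp Require Import all_classical all_reals all_analysis.
From mathcomp Require Import ring lra zify.
From mathcomp Require Import measurable_realfun cyclic separable cyclotomic.

Set Implicit Arguments.
Unset Strict Implicit.
Unset Printing Implicit Defensive.
Import Order.TTheory GRing.Theory Num.Theory.
Import numFieldNormedType.Exports ComplexField.Normc.

Local Open Scope classical_set_scope.
Local Open Scope ring_scope.
Local Open Scope complex_scope.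

(** Write [T] for the Toeplitz operator with symbol [Re z], [S] for multiplication
    by [1 + beta z] and [b = |beta|], so that [A = S^-1 T S].

    Upper bounds.  [T] is a selfadjoint contraction, [|S| <= 1 + b] and
    [|S^-1| <= (1 - b)^-1]; hence [|A^n| <= (1 + b) / (1 - b)]
    ([rnorm_iter_similar]).  The numerical range of [T] lies in [-1, 1]
    ([numerical_range]), so [|l - m| |g| <= |(l - T) g|] for some [m] in [-1, 1]
    that depends on [g].  Since the spectrum of [A] is exactly the segment [-1, 1]
    ([spectrum_similar]), [|l - m|] is at least the distance from [l] to that
    spectrum, which gives the bound on [P(A)] ([resolvent_bound_le]).

    The spectrum.  Off the segment, [l = (w + 1/w) / 2] with [0 < |w| < 1], and the
    Wiener-Hopf factorization of [l - Re z] yields a preimage of every [f] under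
    [l - T] in closed form ([shift_toeplitz_surj]); the lower bound above makes the
    inverse bounded.  For [m] in [-1, 1], a solution of [(m - T) g = 1] would have
    Fourier coefficients of constant modulus 2, although they tend to 0
    ([segment_not_surjective]).

    Lower bounds for [M(A)].  With [k = 1 / (1 + beta z)] one finds
    [A 1 = z / 2 + (beta / 2) k], whose squared norm is
    [(1 - 2 s Re (beta^2)) / (4 s)] where [s = 1 - b^2] ([rnorm_similar_one]).
    Both quantities in the statement are bounded by the larger of 1, which is
    [|A^0|], and [|A 1|]: the first by the latter alone ([first_lower_bound]), the
    second by 1 or by [|A 1|] according to the size of [s]
    ([second_lower_bound]).

    Lower bounds for [P(A)].  Letting [l] tend to infinity gives [1 <= P(A)].  For
    [M(A) <= 2 e P(A)^2], an identity ([dist_segment_sqr]) shows that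
    [dist (l, [-1, 1])^-2 <= |l - 1|^-2 + |l + 1|^-2] off the unit disk, and then
    an argument of El-Fallah and Ransford applies ([power_le_resolvent_sqr]): up
    to the factor [n + 1], the power [A^n] is the mean of
    [l^(n + 2) (l - A)^-2] over a circle of radius [r > 1].  The mean is taken here
    over the vertices of regular polygons, with an error that vanishes as the
    number of vertices grows, so that no operator-valued integral is needed. *)

(** * The real-valued norm *)

Section real_norm.
Context (R : realType) (V : normedModType R[i]).
Implicit Types (x y : V).

Lemma rnormE x : `|x| = (rnorm x)%:C.
Proof.
by have := normr_ge0 x; rewrite /rnorm; case: `|x| => a b; rewrite lecE/= => /andP[/eqP-> _].
Qed.

Lemma rnorm_ge0 x : 0 <= rnorm x.
Proof. by rewrite -lecR -rnormE normr_ge0. Qed.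

Lemma rnormD x y : rnorm (x + y) <= rnorm x + rnorm y.
Proof. by rewrite -lecR rmorphD/= -!rnormE ler_normD. Qed.

Lemma rnormZ (a : R[i]) x : rnorm (a *: x) = normc a * rnorm x.
Proof. by apply: complexI; rewrite -rnormE normrZ rmorphM/= -rnormE normr_normc. Qed.

Lemma rnormN x : rnorm (- x) = rnorm x.
Proof. by apply: complexI; rewrite -!rnormE normrN. Qed.

Lemma rnormB x y : rnorm (x - y) <= rnorm x + rnorm y.
Proof. by rewrite -(rnormN y) rnormD. Qed.

Lemma rnorm0 : rnorm (0 : V) = 0.
Proof. by apply: complexI; rewrite -rnormE normr0. Qed.

Lemma rnorm_eq0 x : rnorm x = 0 -> x = 0.
Proof. by move=> x0; apply/normr0_eq0; rewrite rnormE x0. Qed.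

Lemma rnorm_sum (I : Type) (r : seq I) (P : pred I) (F : I -> V) :
  rnorm (\sum_(i <- r | P i) F i) <= \sum_(i <- r | P i) rnorm (F i).
Proof.
elim/big_rec2 : _ => [|i a b _ le]; first by rewrite rnorm0.
by apply: le_trans (rnormD _ _) _; rewrite lerD2l.
Qed.

End real_norm.

(** * Sums over roots of unity *)

Section roots_of_unity.
Context (R : realType).
Local Notation C := R[i].
Implicit Types (z w : C).

Lemma sqr_normc_ReIm z : normc z ^+ 2 = complex.Re z ^+ 2 + complex.Im z ^+ 2.
Proof. by rewrite Defs.normcE sqr_sqrtr// addr_ge0// sqr_ge0. Qed.

Lemma Re_sum (I : Type) (r : seq I) (P : pred I) (F : I -> C) :
  complex.Re (\sum_(i <- r | P i) F i) = \sum_(i <- r | P i) complex.Re (F i).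
Proof. by elim/big_rec2 : _ => [//|i a b _ <-]; rewrite ReD. Qed.

Lemma normc_real (x : R) : normc x%:C = `|x|.
Proof. by rewrite Defs.normcE/= expr0n addr0 sqrtr_sqr. Qed.

Lemma normcX z n : normc (z ^+ n) = normc z ^+ n.
Proof.
elim: n => [|n IH]; first by rewrite !expr0 normc1.
by rewrite !exprS normcM IH.
Qed.

Lemma primitive_root_exists N : (0 < N)%N -> exists w : C, N.-primitive_root w.
Proof.
move=> N0; pose p : {poly C} := 'X^N - 1.
have [r Dp] := closed_field_poly_normal p.
rewrite (monicP _) ?monicXnsubC// scale1r in Dp.
have rn1 : all N.-unity_root r by apply/allP => z; rewrite -root_prod_XsubC -Dp.
have sz_r : (N < (size r).+1)%N.
  by rewrite -(size_prod_XsubC r id) -Dp size_XnsubC.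
have [|z] := hasP (has_prim_root N0 rn1 _ sz_r); last by exists z.
by rewrite -separable_prod_XsubC -Dp separable_Xn_sub_1 // pnatr_eq0 -lt0n.
Qed.

Variables (N : nat) (w : C).
Hypothesis wN : N.-primitive_root w.

Lemma normc_primitive_root : normc w = 1.
Proof.
apply/eqP; rewrite -(@pexpr_eq1 _ _ N) ?normc_ge0//.
  by rewrite -normcX (prim_expr_order wN) normc1.
exact: prim_order_gt0 wN.
Qed.

Lemma sum_primitive_root m :
  \sum_(j < N) (w ^+ j) ^+ m = if (N %| m)%N then N%:R else 0.
Proof.
under eq_bigr do rewrite exprAC.
rewrite (prim_order_dvd wN); case: eqP => [->|/eqP wm1].
  by under eq_bigr do rewrite expr1n; rewrite sumr_const card_ord.
apply/eqP; have := subrX1 (w ^+ m) N.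
rewrite exprAC (prim_expr_order wN) expr1n subrr => /esym/eqP.
by rewrite mulf_eq0 subr_eq0 (negbTE wm1).
Qed.

Variable a : R.
Hypothesis a1 : 1 < a.

(** The Poisson kernel at the point 1, up to a constant factor, summed over the vertices of a regular
    polygon inscribed in the circle of radius [a]. *)
Lemma sum_poisson :
  \sum_(j < N) (normc (a%:C * w ^+ j - 1) ^+ 2)^-1 =
  N%:R * (a ^+ 2 - 1)^-1 * (1 + 2 / (a ^+ N - 1)).
Proof.
have N0 : (0 < N)%N := prim_order_gt0 wN.
have a0 : 0 < a by rewrite (lt_trans _ a1).
have nmu (j : 'I_N) : normc (a%:C * w ^+ j) = a.
  by rewrite normcM normcX normc_primitive_root expr1n mulr1 normc_real gtr0_norm.
have aN : 1 < a ^+ N by rewrite exprn_egt1// -lt0n.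
have a2 : 1 < a ^+ 2 by rewrite exprn_egt1.
(* pointwise, |mu|^2 - 1 = |mu - 1|^2 (1 + 2 Re (1 / (mu - 1))) *)
have poisson (j : 'I_N) : (normc (a%:C * w ^+ j - 1) ^+ 2)^-1 =
    (a ^+ 2 - 1)^-1 * (1 + 2 * complex.Re (a%:C * w ^+ j - 1)^-1).
  have := nmu j; case: (a%:C * w ^+ j) => x y nxy.
  have : normc (x +i* y) ^+ 2 = a ^+ 2 by rewrite nxy.
  rewrite !sqr_normc_ReIm/= subr0 => e.
  rewrite -e; have h0 : (x - 1) ^+ 2 + y ^+ 2 != 0.
    apply/eqP => h0; have /eqP := h0; rewrite paddr_eq0 ?sqr_ge0// !sqrf_eq0 subr_eq0.
    by case/andP => /eqP x1 /eqP y0; move: a2; rewrite -e x1 y0; lra.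
  have h1 : x ^+ 2 + y ^+ 2 - 1 != 0 by apply/eqP; move: a2; rewrite -e; lra.
  by field; rewrite h0 h1.
under eq_bigr do rewrite poisson.
rewrite -mulr_sumr [_ * _^-1]mulrC -mulrA; congr (_ * _).
rewrite big_split/= sumr_const card_ord -mulr_sumr mulrDr mulr1; congr (_ + _).
rewrite -Re_sum.
have mu1 (j : 'I_N) : a%:C * w ^+ j - 1 != 0.
  rewrite subr_eq0; apply/eqP => h; have := nmu j; rewrite h normc1 => /eqP.
  by rewrite lt_eqF.
(* mu^N = a^N, so that mu - 1 divides the scalar a^N - 1 *)
have inv (j : 'I_N) : (a%:C * w ^+ j - 1)^-1 =
    (a ^+ N - 1)^-1%:C * \sum_(m < N) a%:C ^+ m * (w ^+ j) ^+ m.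
  have := subrX1 (a%:C * w ^+ j) N.
  rewrite exprMn -exprM mulnC exprM (prim_expr_order wN) expr1n mulr1 => h.
  have aN1 : a%:C ^+ N - 1 != 0 :> C.
    by rewrite -rmorphXn -(rmorph1 (real_complex R)) -rmorphB/= (inj_eq (@complexI R) _ 0) subr_eq0 gt_eqF.
  under eq_bigr do rewrite -exprMn.
  apply: (mulfI (mu1 j)); rewrite divff// mulrCA -h.
  by rewrite fmorphV rmorphB/= rmorphXn rmorph1 mulVf.
under eq_bigr do rewrite inv.
rewrite -mulr_sumr exchange_big/=.
under eq_bigr do rewrite -mulr_sumr sum_primitive_root.
rewrite (bigD1 (Ordinal N0))//= dvdn0 mul1r big1 ?addr0; last first.
  move=> m m0; rewrite gtnNdvd ?mulr0//.
  by rewrite lt0n; apply: contra m0 => /eqP m0; apply/eqP/val_inj.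
rewrite -(rmorph_nat (real_complex R)) -rmorphM/=.
by ring.
Qed.

End roots_of_unity.

(** * From resolvent bounds to power bounds *)

Section kreiss_ritt.
Context (R : realType) (V : normedModType R[i]).
Local Notation C := R[i].
Variables (A : V -> V) (K p : R).
Hypotheses (K0 : 0 <= K) (p0 : 0 <= p).
Hypothesis linA : linear A.
Hypothesis AK : forall m x, rnorm (iter m A x) <= K * rnorm x.

(** The sum [|l - 1|^-2 + |l + 1|^-2] over a common denominator. *)
Definition invsq_dist_pm1 (l : C) : R :=
  2 * (normc l ^+ 2 + 1) / normc (l ^+ 2 - 1) ^+ 2.

Hypothesis resA : forall l : C, 1 < normc l -> exists B : V -> V,
  cancel (shift_op l A) B /\
  forall x, rnorm (B x) <= p * Num.sqrt (invsq_dist_pm1 l) * rnorm x.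

Let A0 : A 0 = 0.
Proof. by have := linA (-1) 0 0; rewrite scaler0 addr0 scaleN1r => ->; rewrite addNr. Qed.

Let AD x y : A (x + y) = A x + A y.
Proof. by rewrite -[x]scale1r linA !scale1r. Qed.

Let AZ (a : C) x : A (a *: x) = a *: A x.
Proof. by rewrite -[a *: x]addr0 linA A0 addr0. Qed.

Let Asum (I : Type) (r : seq I) (P : pred I) (F : I -> V) :
  A (\sum_(i <- r | P i) F i) = \sum_(i <- r | P i) A (F i).
Proof. by elim/big_rec2 : _ => [|i a b _ <-]; rewrite ?A0 ?AD. Qed.

Let iter_add m x y : iter m A (x + y) = iter m A x + iter m A y.
Proof. by elim: m => //= m ->; rewrite AD. Qed.

Let iterZ m (a : C) x : iter m A (a *: x) = a *: iter m A x.
Proof. by elim: m => //= m ->; rewrite AZ. Qed.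

Let itersum m (I : Type) (r : seq I) (P : pred I) (F : I -> V) :
  iter m A (\sum_(i <- r | P i) F i) = \sum_(i <- r | P i) iter m A (F i).
Proof. by elim: m => //= m ->; rewrite Asum. Qed.

(** The quotient of [l ^ N - A ^ N] by [l - A]. *)
Definition geometric_quotient N (l : C) (x : V) : V :=
  \sum_(m < N) l ^+ (N.-1 - m) *: iter m A x.

Lemma shift_geometric_quotient N l x : (0 < N)%N ->
  shift_op l A (geometric_quotient N l x) = l ^+ N *: x - iter N A x.
Proof.
case: N => // N _; rewrite /shift_op /geometric_quotient Asum scaler_sumr.
under [X in X - _]eq_bigr do rewrite scalerA -exprS.
under [X in _ - X]eq_bigr do rewrite AZ -iterS.
rewrite big_ord_recl [X in _ - X]big_ord_recr/= subn0 subnn expr0 scale1r.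
set S1 := \sum_(i < N) _; set S2 := \sum_(i < N) _.
suff -> : S1 = S2 by rewrite opprD addrA addrK.
apply: eq_bigr => i _.
by rewrite /bump add1n subnS prednK// subn_gt0.
Qed.

(** If [B] inverts [l - A], then [B ^ 2 (l ^ N - A ^ N) ^ 2] is the square of the
    geometric quotient. *)
Lemma resolvent_sqr N l B x : (0 < N)%N -> cancel (shift_op l A) B ->
  let E y := l ^+ N *: y - iter N A y in
  B (B (E (E x))) =
  \sum_(m < N) \sum_(k < N) l ^+ (2 * N.-1 - (m + k)) *: iter (m + k) A x.
Proof.
move=> N0 BK E.
have BE y : B (E y) = geometric_quotient N l y.
  by rewrite /E -shift_geometric_quotient.
have GE : geometric_quotient N l (E x) = E (geometric_quotient N l x).
  rewrite /geometric_quotient /E itersum scaler_sumr -sumrB; apply: eq_bigr => m _.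
  rewrite -scaleN1r iter_add !iterZ scaleN1r scalerBr !scalerA mulrC; congr (_ - _ *: _).
  by rewrite -!iterD addnC.
rewrite BE GE BE /geometric_quotient; apply: eq_bigr => m _.
rewrite itersum scaler_sumr; apply: eq_bigr => k _.
rewrite iterZ scalerA -exprD -iterD; congr (_ ^+ _ *: _).
have := ltn_ord m; have := ltn_ord k; lia.
Qed.

Lemma sum_diagonal_le (N k : nat) (c : R) : 0 <= c ->
  \sum_(m < N) \sum_(l < N) (if (m + l == k)%N then c else 0) <= N%:R * c.
Proof.
move=> c0; apply: (@le_trans _ _ (\sum_(m < N) c)); last first.
  by rewrite sumr_const card_ord mulr_natl.
apply: ler_sum => m _; case: (pickP (fun l : 'I_N => (m + l == k)%N)) => [l /eqP ml|no].
  rewrite (bigD1 l)//= ml eqxx big1 ?addr0// => i il; case: eqP => // mi.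
  by move/eqP: il; case; apply: val_inj => /=; lia.
by rewrite big1// => l _; rewrite no.
Qed.

Lemma sum_antidiagonal (N n : nat) (x : V) : (n < N)%N ->
  \sum_(m < N) \sum_(l < N) (if (m + l == n)%N then x else 0) = n.+1%:R *: x.
Proof.
move=> nN; rewrite [RHS]scaler_nat.
transitivity (\sum_(m < N) (if (m < n.+1)%N then x else 0)).
  apply: eq_bigr => m _; case: ifPn => mn.
    have lN : (n - m < N)%N by lia.
    rewrite (bigD1 (Ordinal lN))//= subnKC// eqxx big1 ?addr0// => i il.
    case: eqP => // mi; move/eqP: il; case; apply: val_inj => /=; lia.
  by rewrite big1// => l _; case: eqP => //; move: mn; lia.
by rewrite -big_mkcond/= -(big_ord_widen _ (fun=> x)) // sumr_const card_ord.
Qed.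

(** The mean over the [N] points [r w^j], with [w] a primitive root of unity, of
    [l^(n + 2) B^2 (l^N - A^N)^2], where [B] is the resolvent.  By [resolvent_sqr]
    it consists of [n + 1] terms in [A^n] and of at most [N] terms in
    [A^(n + N)].  As [N] is odd, the squares of the points are, up to the factor
    [r^2], again all the [N]-th roots of unity, and [sum_poisson] evaluates the
    mean of the bound on [B^2]. *)
Lemma iter_bound N n (r : R) x : odd N -> (n < N)%N -> 1 < r ->
  n.+1%:R * (r ^+ N) ^+ 2 * rnorm (iter n A x) <=
  r ^+ n.+2 * p ^+ 2 * (2 / (r ^+ 2 - 1) * (1 + 2 / ((r ^+ 2) ^+ N - 1))) *
    (r ^+ N + K) ^+ 2 * rnorm x + N%:R * r ^+ N * K * rnorm x.
Proof.
move=> oddN nN r1; have N0 : (0 < N)%N by apply: leq_ltn_trans nN.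
have r0 : 0 < r by rewrite (lt_trans _ r1).
have [w wN] := @primitive_root_exists R N N0.
have w2N : N.-primitive_root (w ^+ 2).
  by have := exp_prim_root wN 2;
  rewrite (_ : gcdn 2 N = 1%N) ?divn1//; apply/eqP;
  rewrite -/(coprime 2 N) coprime2n.
pose l (j : 'I_N) : C := r%:C * w ^+ j.
have nl j : normc (l j) = r.
  by rewrite normcM normcX (normc_primitive_root wN) expr1n mulr1 normc_real gtr0_norm.
have lN j : l j ^+ N = (r ^+ N)%:C.
  by rewrite exprMn -exprM mulnC exprM (prim_expr_order wN) expr1n mulr1 rmorphXn.
have resE j : exists y, y = \sum_(m < N) \sum_(k < N)
    l j ^+ (2 * N.-1 - (m + k)) *: iter (m + k) A x /\
    rnorm y <= p ^+ 2 * invsq_dist_pm1 (l j) * (r ^+ N + K) ^+ 2 * rnorm x.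
  have [|B [BK nB]] := resA (l := l j); first by rewrite nl.
  pose E y := l j ^+ N *: y - iter N A y.
  have e := resolvent_sqr x N0 BK.
  exists (B (B (E (E x)))); split => //.
  have nE y : rnorm (E y) <= (r ^+ N + K) * rnorm y.
    apply: le_trans (rnormB _ _) _; rewrite rnormZ mulrDl lerD//.
    by rewrite lN normc_real ger0_norm// exprn_ge0// ltW.
  have rK : 0 <= r ^+ N + K by rewrite addr_ge0// exprn_ge0// ltW.
  set q := invsq_dist_pm1 _ in nB *.
  have q0 : 0 <= q by rewrite /q /invsq_dist_pm1 divr_ge0 ?sqr_ge0// mulr_ge0// addr_ge0// sqr_ge0.
  have c0 : 0 <= p * Num.sqrt q by rewrite mulr_ge0// sqrtr_ge0.
  apply: le_trans (nB _) _.
  apply: (@le_trans _ _ (p * Num.sqrt q * (p * Num.sqrt q * ((r ^+ N + K) * ((r ^+ N + K) * rnorm x))))).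
    rewrite ler_wpM2l//; apply: le_trans (nB _) _; rewrite ler_wpM2l//.
    by apply: le_trans (nE _) _; rewrite ler_wpM2l.
  have := sqr_sqrtr q0; set t := Num.sqrt q => tq.
  by rewrite -tq le_eqVlt; apply/orP; left; apply/eqP; ring.
have {resE} [y yE] : exists y : 'I_N -> V, forall j, y j = \sum_(m < N) \sum_(k < N)
    l j ^+ (2 * N.-1 - (m + k)) *: iter (m + k) A x /\
    rnorm (y j) <= p ^+ 2 * invsq_dist_pm1 (l j) * (r ^+ N + K) ^+ 2 * rnorm x.
  by have [f fE] := boolp.choice resE; exists f.
pose Z := \sum_(m < N) \sum_(k < N)
  (if (m + k == n + N)%N then (r ^+ N)%:C *: iter (n + N) A x else 0).
have nZ : rnorm Z <= N%:R * r ^+ N * K * rnorm x.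
  have -> : N%:R * r ^+ N * K * rnorm x = N%:R * (r ^+ N * (K * rnorm x)) by ring.
  have c0 : 0 <= r ^+ N * (K * rnorm x).
    by rewrite mulr_ge0 ?mulr_ge0 ?rnorm_ge0// exprn_ge0// ltW.
  apply: le_trans (sum_diagonal_le N (n + N) c0).
  apply: le_trans (rnorm_sum _ _ _) _; apply: ler_sum => m _.
  apply: le_trans (rnorm_sum _ _ _) _; apply: ler_sum => k _.
  case: ifP => _; last by rewrite rnorm0.
  rewrite rnormZ normc_real ger0_norm ?exprn_ge0 ?(ltW r0)// ler_wpM2l//.
  by rewrite exprn_ge0 ?(ltW r0).
(* the coefficient of A^(m + k) is the sum of the l^(2 N + n - (m + k)), which
   vanishes unless N divides the exponent, that is m + k = n or m + k = n + N *)
have key : N%:R *: (n.+1%:R *: (((r ^+ N) ^+ 2)%:C *: iter n A x) + Z) =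
    \sum_(j < N) l j ^+ n.+2 *: y j.
  transitivity (\sum_(m < N) \sum_(k < N) \sum_(j < N)
      l j ^+ (2 * N + n - (m + k)) *: iter (m + k) A x); last first.
    under eq_bigr do rewrite exchange_big/=.
    rewrite exchange_big/=; apply: eq_bigr => j _.
    rewrite (yE _).1 scaler_sumr; apply: eq_bigr => m _; rewrite scaler_sumr.
    apply: eq_bigr => k _; rewrite scalerA -exprD; congr (_ ^+ _ *: _).
    have := ltn_ord m; have := ltn_ord k; lia.
  rewrite -(sum_antidiagonal _ nN) -big_split scaler_sumr/=.
  apply: eq_bigr => m _; rewrite -big_split scaler_sumr/=; apply: eq_bigr => k _.
  rewrite -scaler_suml.
  under eq_bigr do rewrite exprMn.
  rewrite -mulr_sumr (sum_primitive_root wN).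
  have mN := ltn_ord m; have kN := ltn_ord k.
  case: ifPn => [/eqP mkn|mkn].
    rewrite mkn -[X in (X == _)%N]addn0 eqn_add2l ifF; last by apply/eqP; lia.
    by rewrite addnK dvdn_mull// addr0 scalerA mulrC mulnC exprM rmorphXn/= rmorphXn.
  rewrite add0r; case: ifPn => [/eqP mkN|mkN].
    rewrite mkN (_ : 2 * N + n - (n + N) = N)%N; last by lia.
    by rewrite dvdnn scalerA mulrC rmorphXn.
  rewrite ifF ?mulr0 ?scaler0 ?scale0r//; apply/negbTE/dvdnP => -[[|[|[|q]]]]; nia.
have sumq : \sum_(j < N) invsq_dist_pm1 (l j) =
    N%:R * (2 / (r ^+ 2 - 1) * (1 + 2 / ((r ^+ 2) ^+ N - 1))).
  transitivity (2 * (r ^+ 2 + 1) * \sum_(j < N) (normc ((r ^+ 2)%:C * (w ^+ 2) ^+ j - 1) ^+ 2)^-1).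
    rewrite mulr_sumr; apply: eq_bigr => j _; rewrite /invsq_dist_pm1 nl.
    by rewrite exprMn exprAC rmorphXn.
  rewrite (sum_poisson w2N); last by rewrite exprn_egt1.
  have h1 : r ^+ 2 - 1 != 0 by rewrite subr_eq0 gt_eqF// exprn_egt1.
  have h2 : r ^+ 2 + 1 != 0 by rewrite gt_eqF// ltr_wpDl// sqr_ge0.
  have h3 : (r ^+ 2) ^+ N - 1 != 0 by rewrite subr_eq0 gt_eqF// exprn_egt1 -?lt0n// exprn_egt1.
  have -> : (r ^+ 2) ^+ 2 - 1 = (r ^+ 2 - 1) * (r ^+ 2 + 1) by ring.
  by move: h3; set c := _ ^+ N => h3; field; rewrite h1 h2 h3.
have N0' : 0 < N%:R :> R by rewrite ltr0n.
have main : N%:R * rnorm (n.+1%:R *: (((r ^+ N) ^+ 2)%:C *: iter n A x) + Z) <=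
    N%:R * (r ^+ n.+2 * p ^+ 2 * (2 / (r ^+ 2 - 1) * (1 + 2 / ((r ^+ 2) ^+ N - 1))) *
    (r ^+ N + K) ^+ 2 * rnorm x).
  have -> : N%:R = normc (N%:R : C).
    by rewrite -(rmorph_nat (real_complex R)) normc_real ger0_norm.
  rewrite -rnormZ key -(rmorph_nat (real_complex R)) normc_real ger0_norm//.
  apply: le_trans (rnorm_sum _ _ _) _.
  apply: (@le_trans _ _ (\sum_(j < N) invsq_dist_pm1 (l j) *
     (r ^+ n.+2 * p ^+ 2 * (r ^+ N + K) ^+ 2 * rnorm x))).
    apply: ler_sum => j _; rewrite rnormZ normcX nl.
    apply: le_trans (ler_wpM2l _ (yE j).2) _; first by rewrite exprn_ge0// ltW.
    by rewrite le_eqVlt; apply/orP; left; apply/eqP; ring.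
  by rewrite -mulr_suml sumq le_eqVlt; apply/orP; left; apply/eqP; ring.
move: main; rewrite ler_pM2l// => main.
have -> : n.+1%:R * (r ^+ N) ^+ 2 * rnorm (iter n A x) =
    rnorm (n.+1%:R *: (((r ^+ N) ^+ 2)%:C *: iter n A x)).
  rewrite !rnormZ -(rmorph_nat (real_complex R)) !normc_real !ger0_norm ?sqr_ge0//.
  by rewrite mulrA.
rewrite -[X in rnorm X](addrK Z); apply: le_trans (rnormB _ _) _.
exact: lerD.
Qed.

End kreiss_ritt.
Lemma bernoulli_le (R : realType) (s : R) N : 1 <= s -> N%:R * (s - 1) <= s ^+ N.
Proof.
move=> s1; elim: N => [|N IH]; first by rewrite mul0r.
rewrite exprS -natr1 mulrDl mul1r.
have sN : 1 <= s ^+ N by rewrite exprn_ege1.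
have : (s - 1) * 1 <= (s - 1) * s ^+ N by rewrite ler_wpM2l// subr_ge0.
lra.
Qed.

(** El-Fallah and Ransford's argument: if the powers of [A] are bounded and the
    resolvent satisfies [|(l - A)^-1|^2 <= p^2 (|l - 1|^-2 + |l + 1|^-2)] off the
    closed unit disk, then the powers are bounded by [2 e p^2].  The bound [K]
    does not enter the conclusion. *)
Lemma power_le_resolvent_sqr (R : realType) (V : normedModType R[i])
    (A : V -> V) (K p : R) : 0 <= K -> 0 <= p -> linear A ->
  (forall m x, rnorm (iter m A x) <= K * rnorm x) ->
  (forall l : R[i], 1 < normc l -> exists B : V -> V,
    cancel (shift_op l A) B /\
    forall x, rnorm (B x) <= p * Num.sqrt (invsq_dist_pm1 l) * rnorm x) ->
  forall n x, rnorm (iter n A x) <= 2 * expR 1 * p ^+ 2 * rnorm x.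
Proof.
move=> K0 p0 linA AK resA n x.
(* this radius keeps r^(n + 2) below e, and r^2 - 1 above 2 / (n + 2) *)
pose h : R := n.+2%:R^-1; have h0 : 0 < h by rewrite invr_gt0.
pose r := 1 + h; have r1 : 1 < r by rewrite ltrDl.
have r0 : 0 < r by rewrite (lt_trans _ r1).
pose s := Num.sqrt r; have s2 : s ^+ 2 = r by rewrite sqr_sqrtr// ltW.
have s0 : 0 <= s by exact: sqrtr_ge0.
have s1 : 1 < s by rewrite -(@ltr_pXn2r _ 2)// ?nnegrE// expr1n s2.
pose c := r ^+ n.+2 * p ^+ 2 * (2 / (r ^+ 2 - 1)).
pose X := rnorm x; have X0 : 0 <= X := rnorm_ge0 x.
(* the bound of [iter_bound] divided by r^(2 N), at t = s^-N with s^2 = r;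
   since N (s - 1) <= s^N, the factor N r^-N is at most t / (s - 1) *)
pose B (t : R) := c * (1 + 2 * t ^+ 4 * (1 - t ^+ 4)^-1) * (1 + K * t ^+ 2) ^+ 2 * X +
  t * ((s - 1)^-1 * K * X).
pose N k := (n + k).*2.+1.
have bound k : n.+1%:R * rnorm (iter n A x) <= B (s^-1 ^+ N k).
  have nN : (n < N k)%N by rewrite /N; lia.
  have oN : odd (N k) by rewrite /N /= odd_double.
  have := iter_bound K0 p0 linA AK resA x oN nN r1.
  have rN : r ^+ N k = (s ^+ N k) ^+ 2 by rewrite -s2 exprAC.
  rewrite -/X [(r ^+ 2) ^+ _]exprAC rN -(exprM _ 2 2) (_ : 2 * 2 = 4)%N//.
  have sN : 1 < s ^+ N k by rewrite exprn_egt1.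
  rewrite exprVn; have bern := bernoulli_le (N k) (ltW s1).
  move: bern sN; set q := s ^+ N k => bern q1.
  have q0 : 0 < q by rewrite (lt_trans _ q1).
  have q40 : 0 < q ^+ 4 by rewrite exprn_gt0.
  have q41 : q ^+ 4 - 1 != 0 by rewrite subr_eq0 gt_eqF// exprn_egt1.
  have r2 : r ^+ 2 - 1 != 0 by rewrite subr_eq0 gt_eqF// exprn_egt1.
  have s10 : s - 1 != 0 by rewrite subr_eq0 gt_eqF.
  move=> main; rewrite -(ler_pM2l q40).
  have -> : q ^+ 4 * (n.+1%:R * rnorm (iter n A x)) =
    n.+1%:R * q ^+ 4 * rnorm (iter n A x) by ring.
  apply: le_trans main _.
  have -> : q ^+ 4 * B q^-1 = r ^+ n.+2 * p ^+ 2 *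
      (2 / (r ^+ 2 - 1) * (1 + 2 / (q ^+ 4 - 1))) * (q ^+ 2 + K) ^+ 2 * X +
      q / (s - 1) * q ^+ 2 * K * X.
    have e : 1 - q^-1 ^+ 4 != 0.
      by rewrite exprVn subr_eq0 eq_sym invr_eq1 -subr_eq0.
    rewrite /B /c.
    have -> : (1 - q^-1 ^+ 4)^-1 = q ^+ 4 / (q ^+ 4 - 1).
      rewrite -[RHS]invrK invfM invrK; congr (_ ^-1).
      by field; rewrite (gt_eqF q0).
    by field; rewrite (gt_eqF q0) q41 r2 s10.
  rewrite lerD2l ler_wpM2r// ler_wpM2r// ler_wpM2r ?sqr_ge0//.
  by rewrite ler_pdivlMr// subr_gt0.
have cB : B (s^-1 ^+ N k) @[k --> \oo] --> c * X.
  have sN0 : s^-1 ^+ N k @[k --> \oo] --> (0 : R).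
    apply: (@squeeze_cvgr _ _ _ _ (fun=> 0) (fun k => s^-1 ^+ k)); last first.
    - apply: cvg_expr; rewrite ger0_norm ?invr_ge0// invf_lt1//.
      by rewrite (lt_trans _ s1).
    - exact: cvg_cst.
    - apply: nearW => k; rewrite exprn_ge0 ?invr_ge0//=.
      apply: ler_wiXn2l; rewrite ?invr_ge0// ?invf_le1 ?(ltW s1)//.
        by rewrite (lt_trans _ s1).
      by rewrite /N; lia.
  have -> : c * X = B 0.
    by rewrite /B !expr0n/=; ring.
  have contB : {for 0, continuous B}.
    have idc : t @[t --> (0 : R)] --> (0 : R) by exact: cvg_id.
    have X4 : t ^+ 4 @[t --> (0 : R)] --> (0 : R) ^+ 4 by exact: exprn_continuous.
    have X2 : t ^+ 2 @[t --> (0 : R)] --> (0 : R) ^+ 2 by exact: exprn_continuous.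
    apply: cvgD; last by apply: cvgM => //; exact: cvg_cst.
    apply: cvgM; last exact: cvg_cst.
    apply: cvgM.
      apply: cvgM; first exact: cvg_cst.
      apply: cvgD; first exact: cvg_cst.
      apply: cvgM; first by apply: cvgM => //; exact: cvg_cst.
      apply: cvgV; first by rewrite expr0n/= subr0 oner_neq0.
      by apply: cvgB => //; exact: cvg_cst.
    apply: (@cvg_comp _ _ _ (fun t : R => 1 + K * t ^+ 2) (fun u => u ^+ 2) _
      (nbhs (1 + K * 0 ^+ 2))); last exact: exprn_continuous.
    apply: cvgD; first exact: cvg_cst.
    by apply: cvgM => //; exact: cvg_cst.
  exact: (cvg_comp _ _ sN0 contB).
have le1 : n.+1%:R * rnorm (iter n A x) <= c * X.
  by apply: (cvgr_to_ge cB); apply: nearW => k; exact: bound.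
have n1 : 0 < n.+1%:R :> R by [].
rewrite -(ler_pM2l n1); apply: le_trans le1 _.
have -> : n.+1%:R * (2 * expR 1 * p ^+ 2 * rnorm x) =
  expR 1 * p ^+ 2 * (2 * n.+1%:R) * X by rewrite /X; ring.
rewrite ler_wpM2r// /c.
have re : r ^+ n.+2 <= expR 1.
  rewrite (_ : 1 = n.+2%:R * h); last by rewrite /h mulfV.
  rewrite expRM_natl; apply: lerXn2r; rewrite ?nnegrE ?expR_ge0 ?(ltW r0)//.
  exact: expR_ge1Dx.
have h2 : 2 / (r ^+ 2 - 1) <= 2 * n.+1%:R.
  have hn : n.+2%:R * h = 1 by rewrite mulfV.
  rewrite ler_pdivrMr ?subr_gt0 ?exprn_egt1//.
  have -> : r ^+ 2 - 1 = h * (2 + h) by rewrite /r; ring.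
  have e1 : n.+2%:R = n.+1%:R + 1 :> R by rewrite natr1.
  have : n.+1%:R * h = 1 - h by rewrite -[X in _ = X - _]hn e1; ring.
  have n10 : 1 <= n.+1%:R :> R by rewrite ler1n.
  have hh : h <= 2^-1 by rewrite lef_pV2 ?posrE// ler_nat.
  move=> e; rewrite -mulrA (mulrA _ h) e; nra.
have r21 : 0 <= 2 / (r ^+ 2 - 1) by rewrite divr_ge0// subr_ge0 ltW// exprn_egt1.
apply: ler_pM => //; last by rewrite ler_wpM2r ?sqr_ge0.
by rewrite mulr_ge0 ?sqr_ge0// exprn_ge0// ltW.
Qed.

(** * Complex integrals and the inner product *)

Section complex_integral.
Context d (T : measurableType d) (R : realType) (mu : {measure set T -> \bar R}).
Local Notation C := R[i].
(* In [ring_scope] this notation would denote the conjugation of closed fields,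
   which is convertible, but not syntactically equal, to [conjc]. *)
Local Notation "z ^*" := (conjc z) : ring_scope.
Implicit Types (f g : T -> C) (u : T -> R).

Lemma ReJ (z : C) : complex.Re z^* = complex.Re z. Proof. by case: z. Qed.

Lemma ImJ (z : C) : complex.Im z^* = - complex.Im z. Proof. by case: z. Qed.

Lemma normc_conj (z : C) : normc z^* = normc z.
Proof. by rewrite !Defs.normcE ReJ ImJ sqrrN. Qed.

Lemma normc_mulJ (z : C) : z * z^* = (normc z ^+ 2)%:C.
Proof. by rewrite -sqr_normc normr_normc rmorphXn. Qed.

Lemma ler_normRe (z : C) : `|complex.Re z| <= normc z.
Proof.
rewrite Defs.normcE -sqrtr_sqr ler_sqrt ?lerDl ?sqr_ge0//.
by rewrite addr_ge0// sqr_ge0.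
Qed.

Lemma ler_normIm (z : C) : `|complex.Im z| <= normc z.
Proof.
rewrite Defs.normcE -sqrtr_sqr ler_sqrt ?lerDr ?sqr_ge0//.
by rewrite addr_ge0// sqr_ge0.
Qed.

Lemma cmeasurableJ f : cmeasurable f -> cmeasurable (fun t => (f t)^*).
Proof.
move=> [f1 f2]; split.
  by under eq_fun do rewrite ReJ.
by under eq_fun do rewrite ImJ; exact: measurable_funN.
Qed.

(** Integrability and integral of a complex function, by real and imaginary parts. *)
Definition cintegrable f :=
  mu.-integrable setT (EFin \o (fun t => complex.Re (f t))) /\
  mu.-integrable setT (EFin \o (fun t => complex.Im (f t))).

Definition cintegral f : C :=
  (\int[mu]_t complex.Re (f t)) +i* (\int[mu]_t complex.Im (f t)).

Lemma cintegrable_mulJ f g : f \in L2pred mu -> g \in L2pred mu ->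
  cintegrable (fun t => f t * (g t)^*).
Proof.
move=> fL gL.
have /Lfun1_integrable fg := Lfun2_mul_Lfun1 (Lfun_normc fL) (Lfun_normc gL).
have [mR mI] := cmeasurableM (L2pred_cmeas fL) (cmeasurableJ (L2pred_cmeas gL)).
split; apply: (le_integrable measurableT _ _ fg).
- exact/measurable_EFinP.
- move=> t _ /=; rewrite lee_fin (le_trans (ler_normRe _))//.
  by rewrite normcM normc_conj ler_norm.
- exact/measurable_EFinP.
- move=> t _ /=; rewrite lee_fin (le_trans (ler_normIm _))//.
  by rewrite normcM normc_conj ler_norm.
Qed.

Lemma cintegralD f g : cintegrable f -> cintegrable g ->
  cintegral (fun t => f t + g t) = cintegral f + cintegral g.
Proof.
move=> [f1 f2] [g1 g2]; rewrite /cintegral.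
under eq_Rintegral do rewrite ReD.
under [X in _ +i* X]eq_Rintegral do rewrite ImD.
by rewrite !RintegralD.
Qed.

Lemma integrableZ u (k : R) : mu.-integrable setT (EFin \o u) ->
  mu.-integrable setT (EFin \o (fun t => k * u t)).
Proof. by move=> iu; have := integrableZl measurableT k iu. Qed.

Lemma cintegralZ (a : C) f : cintegrable f ->
  cintegral (fun t => a * f t) = a * cintegral f.
Proof.
move=> [f1 f2]; rewrite /cintegral.
under eq_Rintegral do rewrite Defs.ReM.
under [X in _ +i* X]eq_Rintegral do rewrite Defs.ImM.
rewrite RintegralB ?RintegralD ?RintegralZl//; try exact: integrableZ.
by case: a => a b /=; congr (_ +i* _).
Qed.

Lemma cintegralJ f : cintegrable f ->
  cintegral (fun t => (f t)^*) = (cintegral f)^*.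
Proof.
move=> [f1 f2]; rewrite /cintegral /=.
under eq_Rintegral do rewrite ReJ.
under [X in _ +i* X]eq_Rintegral do rewrite ImJ -mulN1r.
by rewrite RintegralZl// mulN1r.
Qed.

Lemma ae_eq_cintegral f g : cmeasurable f -> cmeasurable g ->
  {ae mu, forall t, f t = g t} -> cintegral f = cintegral g.
Proof.
move=> [f1 f2] [g1 g2] fg; rewrite /cintegral; congr (_ +i* _);
  congr fine; apply: ae_eq_integral => //; try exact/measurable_EFinP;
  by apply: filterS fg => t -> _.
Qed.

End complex_integral.

Section L2_inner_product.
Context d (T : measurableType d) (R : realType) (mu : {measure set T -> \bar R}).
Local Notation C := R[i].
Local Notation "z ^*" := (conjc z) : ring_scope.
Local Notation L2T := (L2 mu).
Local Notation L2fun := (L2fun mu).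
Implicit Types (f g : L2fun) (x y : L2T).

(** The inner product does not depend on the representatives. *)
Lemma L2inner_pi f g : L2inner (\pi_L2T%qT f) (\pi_L2T%qT g) =
  cintegral mu (fun t => L2fun_val f t * (L2fun_val g t)^*).
Proof.
have mf (h : L2fun) := L2pred_cmeas (valP h).
apply: ae_eq_cintegral.
- by apply: cmeasurableM; [exact: mf|exact: cmeasurableJ (mf _)].
- by apply: cmeasurableM; [exact: mf|exact: cmeasurableJ (mf _)].
- by apply: filterS2 (L2_repr f) (L2_repr g) => t -> ->.
Qed.

Lemma L2innerDl x y z : L2inner (x + y) z = L2inner x z + L2inner y z.
Proof.
elim/L2W: x => f; elim/L2W: y => g; elim/L2W: z => h.
rewrite -L2_piD !L2inner_pi -cintegralD; last 2 first.
- exact: cintegrable_mulJ (valP f) (valP h).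
- exact: cintegrable_mulJ (valP g) (valP h).
by congr cintegral; apply/funext => t; rewrite L2fun_valD mulrDl.
Qed.

Lemma L2innerZl (a : C) x y : L2inner (a *: x) y = a * L2inner x y.
Proof.
elim/L2W: x => f; elim/L2W: y => g.
rewrite -L2_piZ !L2inner_pi -cintegralZ; last first.
  exact: cintegrable_mulJ (valP f) (valP g).
by congr cintegral; apply/funext => t; rewrite L2fun_valZ mulrA.
Qed.

Lemma L2innerC x y : L2inner x y = (L2inner y x)^*.
Proof.
elim/L2W: x => f; elim/L2W: y => g.
rewrite !L2inner_pi -cintegralJ; last exact: cintegrable_mulJ (valP g) (valP f).
by congr cintegral; apply/funext => t; rewrite rmorphM/= conjcK mulrC.
Qed.

Lemma L2inner_self x : L2inner x x = (rnorm x ^+ 2)%:C.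
Proof.
elim/L2W: x => f; rewrite L2inner_pi.
have -> : rnorm (\pi_L2T%qT f) = L2norm mu (L2fun_val f).
  by apply/L2norm_ae/L2_repr.
have fL := valP f.
have := powR_Lnorm mu (EFin \o (fun t => normc (L2fun_val f t))) (r := 2).
rewrite -(L2normE fL) pnatr_eq0 => /(_ isT) e.
rewrite /cintegral; under eq_Rintegral do rewrite normc_mulJ/=.
under [X in _ +i* X]eq_Rintegral do rewrite normc_mulJ/=.
rewrite Rintegral_cst// mul0r /Rintegral; congr (_ +i* _).
have n0 : 0 <= L2norm mu (L2fun_val f) by rewrite -lee_fin (L2normE fL) Lnorm_ge0.
move: e; rewrite poweR_EFin powR_mulrn// => /(congr1 fine)/= ->.
congr fine; apply: eq_integral => t _ /=.
by rewrite ger0_norm ?normc_ge0// powR_mulrn// normc_ge0.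
Qed.

End L2_inner_product.
(** * Cauchy-Schwarz inequality and bounded multipliers *)

Section L2_geometry.
Context d (T : measurableType d) (R : realType) (mu : {measure set T -> \bar R}).
Local Notation C := R[i].
Local Notation "z ^*" := (conjc z) : ring_scope.
Local Notation L2T := (L2 mu).
Implicit Types (x y z : L2T).

Lemma L2innerDr x y z : L2inner x (y + z) = L2inner x y + L2inner x z.
Proof.
by rewrite L2innerC L2innerDl raddfD/= [L2inner x y]L2innerC [L2inner x z]L2innerC.
Qed.

Lemma L2innerZr (a : C) x y : L2inner x (a *: y) = a^* * L2inner x y.
Proof. by rewrite L2innerC L2innerZl rmorphM/= [L2inner x y]L2innerC. Qed.

Lemma L2innerNl x y : L2inner (- x) y = - L2inner x y.
Proof. by rewrite -scaleN1r L2innerZl mulN1r. Qed.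

Lemma L2innerBl x y z : L2inner (x - y) z = L2inner x z - L2inner y z.
Proof. by rewrite L2innerDl L2innerNl. Qed.

Lemma L2inner0l x : L2inner 0 x = 0.
Proof. by rewrite -(scale0r x) L2innerZl mul0r. Qed.

Lemma L2inner0r x : L2inner x 0 = 0.
Proof. by rewrite L2innerC L2inner0l conjc0. Qed.

Lemma L2inner_eq0 x : L2inner x x = 0 -> x = 0.
Proof.
rewrite L2inner_self => /complexI/eqP; rewrite sqrf_eq0 => /eqP.
exact: rnorm_eq0.
Qed.

Lemma rnormD_sqr x y :
  rnorm (x + y) ^+ 2 = rnorm x ^+ 2 + rnorm y ^+ 2 + 2 * complex.Re (L2inner x y).
Proof.
have : L2inner (x + y) (x + y) =
    L2inner x x + L2inner y y + (L2inner x y + (L2inner x y)^*).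
  by rewrite L2innerDl !L2innerDr [L2inner y x]L2innerC; ring.
rewrite !L2inner_self => /(congr1 (@complex.Re R)); rewrite !ReD ReJ/= => ->.
by ring.
Qed.

(** Expand the square of the norm of [|y|^2 x - <x, y> y]. *)
Lemma L2_cauchy_schwarz x y : normc (L2inner x y) <= rnorm x * rnorm y.
Proof.
have [->|/eqP y0] := eqVneq y 0; first by rewrite L2inner0r normc0 rnorm0 mulr0.
have ny : 0 < rnorm y.
  by rewrite lt0r rnorm_ge0 andbT; apply/eqP => /rnorm_eq0.
set a := L2inner x y.
have := sqr_ge0 (rnorm ((rnorm y ^+ 2)%:C *: x + (- a) *: y)).
rewrite rnormD_sqr L2innerZl L2innerZr -/a !rnormZ normcN normc_real ger0_norm ?sqr_ge0//.
have -> : (rnorm y ^+ 2)%:C * ((- a)^* * a) = (- (rnorm y ^+ 2 * normc a ^+ 2))%:C.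
  have -> : (- a)^* = - a^* by rewrite raddfN.
  by rewrite mulNr [a^* * a]mulrC normc_mulJ mulrN -rmorphM -rmorphN.
rewrite /= => h.
rewrite -(@ler_pXn2r _ 2)// ?nnegrE ?normc_ge0 ?mulr_ge0 ?rnorm_ge0//.
rewrite -(@ler_pM2l _ (rnorm y ^+ 2)) ?exprn_gt0//.
rewrite -subr_ge0; move: h; congr (0 <= _); ring.
Qed.

End L2_geometry.

Section bounded_multipliers.
Context d (T : measurableType d) (R : realType) (mu : {measure set T -> \bar R}).
Local Notation C := R[i].
Local Notation "z ^*" := (conjc z) : ring_scope.
Local Notation L2T := (L2 mu).
Implicit Types (f g : T -> C) (x y : L2T).

(** Bounded measurable functions, the only multipliers that occur below. *)
Definition cbounded f := cmeasurable f /\ exists K : R, forall t, normc (f t) <= K.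

Lemma cbounded_Linfty f : cbounded f -> Linfty mu f.
Proof. by move=> [mf [K fK]]; exact: Linfty_bounded fK. Qed.

Lemma cbounded_cst (c : C) : cbounded (fun=> c).
Proof. by split; [exact: cmeasurable_cst|exists (normc c)]. Qed.

Lemma cboundedD f g : cbounded f -> cbounded g -> cbounded (fun t => f t + g t).
Proof.
move=> [mf [K fK]] [mg [L gL]]; split; first exact: cmeasurableD.
by exists (K + L) => t; rewrite (le_trans (le_normcD _ _))// lerD.
Qed.

Lemma cboundedM f g : cbounded f -> cbounded g -> cbounded (fun t => f t * g t).
Proof.
move=> [mf [K fK]] [mg [L gL]]; split; first exact: cmeasurableM.
by exists (K * L) => t; rewrite normcM ler_pM ?normc_ge0.
Qed.

Lemma cboundedJ f : cbounded f -> cbounded (fun t => (f t)^*).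
Proof.
move=> [mf [K fK]]; split; first exact: cmeasurableJ.
by exists K => t; rewrite normc_conj.
Qed.

Lemma cboundedV f (k : R) : 0 < k -> cbounded f -> (forall t, k <= normc (f t)) ->
  cbounded (fun t => (f t)^-1).
Proof.
move=> k0 [mf _] kf; split; last first.
  by exists k^-1 => t; rewrite normcV lef_pV2 ?posrE// (lt_le_trans k0).
have mV : measurable_fun setT (fun t => (normc (f t))^-1 ^+ 2).
  apply: measurable_funX; under eq_fun do rewrite -powR_inv1 ?normc_ge0//.
  apply: (@measurableT_comp _ _ _ _ _ _ (fun u : R => u `^ (-1))) => //.
  exact: measurable_normc.
have -> : (fun t => (f t)^-1) = (fun t => ((normc (f t))^-1 ^+ 2)%:C * (f t)^*).
  apply/funext => t; have ft : f t != 0.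
    by apply: contraTneq (lt_le_trans k0 (kf t)) => ->; rewrite normc0 ltxx.
  apply: (mulfI ft); rewrite divff// mulrCA normc_mulJ -rmorphM/= exprVn.
  by rewrite mulVf// sqrf_eq0 gt_eqF// (lt_le_trans k0).
apply: cmeasurableM; last exact: cmeasurableJ.
by split => //=; exact: measurable_cst.
Qed.

Lemma L2mulD f x y : cbounded f -> L2mul f (x + y) = L2mul f x + L2mul f y.
Proof.
move=> /cbounded_Linfty fL; elim/L2W: x => g; elim/L2W: y => h.
rewrite -L2_piD !(L2mulE _ fL) -L2_piD; congr (\pi_L2T%qT _); apply/val_inj/funext => t.
by rewrite /= mulrDr.
Qed.

Lemma L2mulZ f (a : C) x : cbounded f -> L2mul f (a *: x) = a *: L2mul f x.
Proof.
move=> /cbounded_Linfty fL; elim/L2W: x => g.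
rewrite -L2_piZ !(L2mulE _ fL) -L2_piZ; congr (\pi_L2T%qT _); apply/val_inj/funext => t.
by rewrite /= mulrCA.
Qed.

Lemma L2mulB f x y : cbounded f -> L2mul f (x - y) = L2mul f x - L2mul f y.
Proof. by move=> fb; rewrite -scaleN1r L2mulD// L2mulZ// scaleN1r. Qed.

Lemma L2mul_cst (c : C) x : L2mul (fun=> c) x = c *: x.
Proof.
elim/L2W: x => g; rewrite (L2mulE _ (cbounded_Linfty (cbounded_cst c))) -L2_piZ.
by congr (\pi_L2T%qT _); apply/val_inj/funext => t.
Qed.

Lemma L2mul_add f g x : cbounded f -> cbounded g ->
  L2mul (fun t => f t + g t) x = L2mul f x + L2mul g x.
Proof.
move=> fb gb; elim/L2W: x => h.
rewrite (L2mulE _ (cbounded_Linfty fb)) (L2mulE _ (cbounded_Linfty gb)).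
rewrite (L2mulE _ (cbounded_Linfty (cboundedD fb gb))) -L2_piD.
by congr (\pi_L2T%qT _); apply/val_inj/funext => t; rewrite /= mulrDl.
Qed.

Lemma L2mul_mul f g x : cbounded f -> cbounded g ->
  L2mul f (L2mul g x) = L2mul (fun t => f t * g t) x.
Proof.
move=> fb gb; elim/L2W: x => h.
rewrite (L2mulE _ (cbounded_Linfty gb)) (L2mulE _ (cbounded_Linfty fb)).
rewrite (L2mulE _ (cbounded_Linfty (cboundedM fb gb))).
by congr (\pi_L2T%qT _); apply/val_inj/funext => t; rewrite /= mulrA.
Qed.

Lemma L2inner_mul f x y : cbounded f ->
  L2inner (L2mul f x) y = L2inner x (L2mul (fun t => (f t)^*) y).
Proof.
move=> fb; elim/L2W: x => g; elim/L2W: y => h.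
rewrite (L2mulE _ (cbounded_Linfty fb)) (L2mulE _ (cbounded_Linfty (cboundedJ fb))).
rewrite !L2inner_pi; congr cintegral; apply/funext => t.
rewrite -[LHS]/(f t * L2fun_val g t * (L2fun_val h t)^*).
rewrite -[RHS]/(L2fun_val g t * ((f t)^* * L2fun_val h t)^*).
by rewrite [in RHS]rmorphM/= conjcK mulrCA mulrA.
Qed.

Lemma rnorm_L2mul_le f g x : cbounded f -> cbounded g ->
  (forall t, normc (f t) <= normc (g t)) -> rnorm (L2mul f x) <= rnorm (L2mul g x).
Proof.
move=> fb gb fg; elim/L2W: x => h.
rewrite (L2mulE _ (cbounded_Linfty fb)) (L2mulE _ (cbounded_Linfty gb)).
set F := MkL2fun _; set G := MkL2fun _.
have nE (k : L2fun mu) : rnorm (\pi_L2T%qT k) = L2norm mu (L2fun_val k).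
  by apply/L2norm_ae/L2_repr.
rewrite !nE -lee_fin (L2normE (valP F)) (L2normE (valP G)).
apply: le_Lnorm2.
- exact: measurable_normc (L2pred_cmeas (valP F)).
- exact: measurable_normc (L2pred_cmeas (valP G)).
- apply: nearW => t /=; rewrite !ger0_norm ?normc_ge0// !normcM.
  by rewrite ler_wpM2r ?normc_ge0.
Qed.

Lemma rnorm_L2mul_upper f (K : R) x : cbounded f -> (forall t, normc (f t) <= K) ->
  rnorm (L2mul f x) <= K * rnorm x.
Proof.
move=> fb fK; have [[t _]|T0] := pselect (exists t : T, True); last first.
  have x0 (y : L2T) : y = 0.
    elim/L2W: y => g; congr (\pi_L2T%qT _); apply/val_inj/funext => t.
    by case: T0; exists t.
  by rewrite (x0 (L2mul f x)) (x0 x) rnorm0 mulr0.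
have K0 : 0 <= K by rewrite (le_trans (normc_ge0 (f t))).
apply: le_trans (rnorm_L2mul_le x fb (cbounded_cst K%:C) _) _.
  by move=> u; rewrite normc_real ger0_norm.
by rewrite L2mul_cst rnormZ normc_real ger0_norm.
Qed.

Lemma rnorm_L2mul_lower f (k : R) x : 0 <= k -> cbounded f ->
  (forall t, k <= normc (f t)) -> k * rnorm x <= rnorm (L2mul f x).
Proof.
move=> k0 fb kf.
apply: le_trans (rnorm_L2mul_le x (cbounded_cst k%:C) fb _).
  by rewrite L2mul_cst rnormZ normc_real ger0_norm.
by move=> u; rewrite normc_real ger0_norm.
Qed.

End bounded_multipliers.
(** * Orthogonality of the powers of z *)

Section circle_integrals.
Context (R : realType).
Local Notation C := R[i].
Local Notation "z ^*" := (conjc z) : ring_scope.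
Local Notation theta := (@theta R).

Lemma theta_setT : theta setT = 1%E.
Proof. exact: (@probability_setT _ _ _ (uniform_prob (twopi_gt0 R))). Qed.

(** A continuous function with a periodic primitive has mean 0.  The bound by 1
    makes [1 + u] nonnegative, as the formula for the uniform distribution
    requires. *)
Lemma integral_theta_periodic (u U : R -> R) : continuous u ->
  (forall t, `|u t| <= 1) -> (forall t : R, is_derive t (1 : R) U (u t)) -> U (2 * pi) = U 0 ->
  \int[theta]_t u t = 0.
Proof.
move=> cu u1 dU U2pi.
have mu : measurable_fun [set: measurableTypeR R] u by exact: continuous_measurable_fun.
have theta_fin : (theta setT < +oo)%E by rewrite theta_setT ltry.
have iu : theta.-integrable setT (EFin \o u).
  apply: measurable_bounded_integrable => //.
  exists 1; split; first by [].
  by move=> K K1 t _; rewrite /= (le_trans (u1 t))// ltW.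
have i1 : theta.-integrable setT (EFin \o (fun=> 1)).
  apply: measurable_bounded_integrable => //.
  exists 1; split; first by [].
  by move=> K K1 t _; rewrite /= normr1 ltW.
have : \int[theta]_t (1 + u t) = 1.
  rewrite /Rintegral integral_uniform; last 2 first.
  - by apply/measurable_EFinP; exact: measurable_funD.
  - by move=> t; rewrite lee_fin -lerBlDl sub0r lerNl; have := u1 t; rewrite ler_norml => /andP[]; lra.
  pose F t := t + U t.
  have dF (t : R) : is_derive t (1 : R) F (1 + u t) by rewrite /F; exact: is_deriveD.
  have cF : continuous F.
    move=> t; apply: differentiable_continuous; apply/derivable1_diffP.
    exact: ex_derive.
  rewrite (@continuous_FTC2 _ _ F).
  - rewrite /F U2pi -EFinB subr0 -EFinM /=; have p0 : pi != 0 :> R by rewrite gt_eqF// pi_gt0.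
    by rewrite add0r addrK mulVf// mulf_eq0 pnatr_eq0 (negbTE p0).
  - exact: twopi_gt0.
  - apply: continuous_subspaceT => t.
    by apply: cvgD; [exact: cvg_cst|exact: cu].
  - split.
    + by move=> t _; exact: ex_derive.
    + by apply: cvg_at_right_filter; exact: cF.
    + by apply: cvg_at_left_filter; exact: cF.
  - by move=> t _; rewrite derive1E; exact: derive_val.
rewrite RintegralD// Rintegral_cst//.
have -> : fine (theta setT) = 1 by rewrite theta_setT.
rewrite mul1r => /eqP; by rewrite -subr_eq0 addrAC subrr add0r => /eqP.
Qed.

Lemma zcX n t : zc t ^+ n = cos (n%:R * t) +i* sin (n%:R * t) :> C.
Proof.
elim: n => [|n IH]; first by rewrite expr0 mul0r cos0 sin0.
rewrite exprS IH -natr1 mulrDl mul1r cosD sinD /zc; apply/eqP.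
by rewrite eq_complex Defs.ReM Defs.ImM /=; apply/andP; split; apply/eqP; ring.
Qed.

Lemma periodic_natmul (f : R -> R) n : periodic f (pi *+ 2) -> f (n%:R * (2 * pi)) = f 0.
Proof.
move=> pf.
have -> : n%:R * (2 * pi) = 0 + (pi *+ 2) *+ n :> R by rewrite add0r !mulr_natl.
exact: periodicn.
Qed.

Lemma is_derive_mull (n t : R) : is_derive t (1 : R) (fun t => n * t) n.
Proof.
have := @is_deriveZ _ _ _ id n t 1 1 (is_derive_id t 1).
by rewrite /GRing.scale/= mulr1.
Qed.

Lemma cintegral_zcX n : cintegral theta (fun t => zc t ^+ n.+1) = 0.
Proof.
pose m : R := n.+1%:R; have m0 : m != 0 by rewrite /m.
rewrite /cintegral; apply/eqP; rewrite eq_complex/=; apply/andP; split; apply/eqP.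
- under eq_Rintegral do rewrite zcX/=.
  apply: (@integral_theta_periodic _ (fun t => m^-1 * sin (m * t))).
  + move=> t; apply: (@continuous_comp _ _ _ (fun t => m * t) cos).
      exact: mulrl_continuous.
    exact: continuous_cos.
  + by move=> t; exact: cos_max.
  + move=> t; have d1 := is_derive_mull m t.
    have := @is_deriveZ _ _ _ _ (m^-1) t 1 _
      (@is_derive1_comp _ sin (fun t => m * t) t _ _ (is_derive_sin (m * t)) d1).
    by rewrite /GRing.scale/= mulrCA mulVf// mulr1.
  + by rewrite mulr0 periodic_natmul//; exact: sinD2pi.
- under eq_Rintegral do rewrite zcX/=.
  apply: (@integral_theta_periodic _ (fun t => - m^-1 * cos (m * t))).
  + move=> t; apply: (@continuous_comp _ _ _ (fun t => m * t) sin).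
      exact: mulrl_continuous.
    exact: continuous_sin.
  + by move=> t; exact: sin_max.
  + move=> t; have d1 := is_derive_mull m t.
    have := @is_deriveZ _ _ _ _ (- m^-1) t 1 _
      (@is_derive1_comp _ cos (fun t => m * t) t _ _ (is_derive_cos (m * t)) d1).
    by rewrite /GRing.scale/= [- sin _ * m]mulNr mulrNN mulrCA mulVf// mulr1.
  + by rewrite mulr0 periodic_natmul//; exact: cosD2pi.
Qed.

End circle_integrals.
(** * The Hardy space *)

Section Hardy_space_lemmas.
Context (R : realType).
Local Notation C := R[i].
Local Notation "z ^*" := (conjc z) : ring_scope.
Local Notation theta := (@theta R).
Local Notation L2T := (L2 theta).
Implicit Types (x y : L2T) (g h : H2 R).

Local Notation zcJ := (fun t => (zc t)^*).

Lemma zcJK t : (zc t)^* * zc t = 1 :> C.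
Proof. by rewrite mulrC normc_mulJ normc_zc expr1n. Qed.

Lemma cbounded_zc : cbounded (@zc R).
Proof. by split; [exact: cmeasurable_zc|exists 1 => t; rewrite normc_zc]. Qed.

Lemma cbounded_zcJ : cbounded (zcJ : measurableTypeR R -> C).
Proof. exact: cboundedJ cbounded_zc. Qed.

Lemma L2mul_zpow n : L2mul (@zc R) (zpow R n) = zpow R n.+1.
Proof.
rewrite /zpow (L2mulE _ (cbounded_Linfty _ cbounded_zc)).
by congr (\pi_L2T%qT _); apply/val_inj/funext => t /=; rewrite exprS.
Qed.

Lemma L2mul_zcJK x : L2mul zcJ (L2mul (@zc R) x) = x.
Proof.
rewrite L2mul_mul; [|exact: cbounded_zcJ|exact: cbounded_zc].
by under [X in L2mul X]eq_fun do rewrite zcJK; rewrite L2mul_cst scale1r.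
Qed.

Lemma L2mul_zcJ_zpow n : L2mul zcJ (zpow R n.+1) = zpow R n.
Proof. by rewrite -L2mul_zpow L2mul_zcJK. Qed.

Lemma L2inner_zc x y : L2inner (L2mul (@zc R) x) (L2mul (@zc R) y) = L2inner x y.
Proof. by rewrite L2inner_mul ?L2mul_zcJK//; exact: cbounded_zc. Qed.

Lemma zpow_orthonormal m n : L2inner (zpow R m) (zpow R n) = (m == n)%:R.
Proof.
have zn k : L2inner (zpow R k.+1) (zpow R 0) = 0.
  rewrite L2inner_pi -(cintegral_zcX R k); congr cintegral; apply/funext => t.
  by rewrite -[LHS]/(zc t ^+ k.+1 * (zc t ^+ 0)^*) expr0 conjc1 mulr1.
have z0 : L2inner (zpow R 0) (zpow R 0) = 1.
  rewrite L2inner_pi (_ : (fun t => _) = fun=> 1); last first.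
    by apply/funext => t; rewrite -[LHS]/(zc t ^+ 0 * (zc t ^+ 0)^*) expr0 conjc1 mulr1.
  rewrite /cintegral !Rintegral_cst// mul0r mul1r.
  by rewrite (_ : fine _ = 1)//; exact: congr1 (@theta_setT R).
elim: m n => [|m IH] [|n].
- by rewrite z0.
- by rewrite L2innerC zn conjc0.
- by rewrite zn.
- by rewrite -!L2mul_zpow L2inner_zc IH.
Qed.

Lemma rnorm_zpow n : rnorm (zpow R n) = 1.
Proof.
apply/eqP; rewrite -(@pexpr_eq1 _ _ 2) ?rnorm_ge0//; apply/eqP.
by apply: complexI; rewrite -L2inner_self zpow_orthonormal eqxx.
Qed.

Lemma H2_approx x (e : R) : x \in @H2pred R -> 0 < e ->
  exists2 y, zspan y & rnorm (x - y) < e.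
Proof.
move=> /asboolP cx e0.
have [|y [zy By]] := cx (ball x e%:C); first by apply: nbhsx_ballx; rewrite ltcR.
by exists y => //; move: By; rewrite -ball_normE/= rnormE ltcR.
Qed.

(** The Hardy space is closed, in terms of approximation in norm. *)
Lemma H2_closed x :
  (forall e : R, 0 < e -> exists2 y, y \in @H2pred R & rnorm (x - y) < e) ->
  x \in @H2pred R.
Proof.
move=> ax; apply/asboolP => B /nbhs_ballP[e /= e0 eB].
have er : e = (complex.Re e)%:C by move: e0; rewrite ltcE => /andP[/eqP/= e0 _]; case: e e0 {eB} => a b /= ->.
have e2 : 0 < complex.Re e / 2 by move: e0; rewrite er ltcR => e0; rewrite divr_gt0.
have [y yH xy] := ax _ e2; have [u zu yu] := H2_approx yH e2.
exists u; split => //; apply: eB; rewrite -ball_normE/= rnormE er ltcR.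
have -> : x - u = (x - y) + (y - u) by rewrite addrA subrK.
by apply: le_lt_trans (rnormD _ _) _; rewrite [ltRHS]splitr ltrD.
Qed.

Lemma zpow_H2 n : zpow R n \in @H2pred R.
Proof.
apply/asboolP/subset_closure; exists n.+1, (fun k => (k == n)%:R).
rewrite big_ord_recr/= eqxx scale1r big1 ?add0r// => k _.
by rewrite ltn_eqF ?scale0r.
Qed.

Lemma zspan_ind (P : L2T -> Prop) :
  P 0 -> (forall (a : C) n y, P y -> P (a *: zpow R n + y)) -> forall x, zspan x -> P x.
Proof.
move=> P0 PD x [n [c ->]]; elim/big_rec : _ => // i y _.
exact: PD.
Qed.

(** A bounded linear map preserves the Hardy space as soon as it sends the powers
    of [z] there. *)
Lemma bounded_linear_H2 (F : L2T -> L2T) (K : R) : linear F ->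
  (forall x, rnorm (F x) <= K * rnorm x) -> (forall n, F (zpow R n) \in @H2pred R) ->
  forall x, x \in @H2pred R -> F x \in @H2pred R.
Proof.
move=> linF FK Fz x xH; apply: H2_closed => e e0.
have K1 : 0 < `|K| + 1 by rewrite ltr_wpDl.
have [|y zy xy] := @H2_approx x (e / (`|K| + 1)) xH; first by rewrite divr_gt0.
have F0 : F 0 = 0 by have := linF (-1) 0 0; rewrite scaler0 addr0 scaleN1r => ->; rewrite addNr.
exists (F y).
  elim/zspan_ind : zy => [|a n u uH]; first by rewrite F0 rpred0.
  by rewrite linF rpredD// rpredZ.
have -> : F x - F y = F (x - y).
  by rewrite [in RHS]addrC -[in RHS]scaleN1r linF scaleN1r addrC.
apply: le_lt_trans (FK _) _; apply: (@le_lt_trans _ _ ((`|K| + 1) * rnorm (x - y))).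
  by rewrite ler_wpM2r ?rnorm_ge0// (le_trans (ler_norm K))// lerDl.
by move: xy; rewrite ltr_pdivlMr// mulrC.
Qed.

Lemma L2inner_H2_eq0 x y : (forall n, L2inner x (zpow R n) = 0) ->
  y \in @H2pred R -> L2inner x y = 0.
Proof.
move=> x0 yH; apply: eq0_normc; apply/eqP; rewrite eq_le normc_ge0 andbT.
apply/ler_addgt0Pr => e e0; rewrite add0r.
have K1 : 0 < rnorm x + 1 by rewrite ltr_wpDl ?rnorm_ge0.
have [|u zu yu] := @H2_approx y (e / (rnorm x + 1)) yH; first by rewrite divr_gt0.
have xu : L2inner x u = 0.
  elim/zspan_ind : zu => [|a n v xv]; first by rewrite L2inner0r.
  by rewrite L2innerDr L2innerZr x0 mulr0 xv addr0.
have -> : L2inner x y = L2inner x (y - u).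
  by rewrite L2innerDr -scaleN1r L2innerZr xu mulr0 addr0.
apply: le_trans (L2_cauchy_schwarz _ _) _.
move: yu; rewrite ltr_pdivlMr// => /ltW; apply: le_trans.
by rewrite mulrC ler_wpM2l ?rnorm_ge0// lerDl.
Qed.

(** The Fourier coefficients tend to 0, by density of the polynomials. *)
Lemma H2_coef_to0 x (e : R) : x \in @H2pred R -> 0 < e ->
  exists N, forall n, (N <= n)%N -> normc (L2inner x (zpow R n)) < e.
Proof.
move=> xH e0; have [y [N [c yE]] xy] := H2_approx xH e0.
exists N => n Nn; apply: le_lt_trans xy.
have -> : L2inner x (zpow R n) = L2inner (x - y) (zpow R n).
  rewrite L2innerBl yE (_ : L2inner (\sum_(_ < _) _) _ = 0) ?subr0//.
  elim/big_rec : _ => [|i u _ u0]; first by rewrite L2inner0l.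
  rewrite L2innerDl L2innerZl zpow_orthonormal u0 ltn_eqF ?mulr0 ?addr0//.
  exact: leq_trans Nn.
by apply: le_trans (L2_cauchy_schwarz _ _) _; rewrite rnorm_zpow mulr1.
Qed.

Lemma H2_valD g h : H2_val (g + h) = H2_val g + H2_val h. Proof. by []. Qed.

Lemma H2_valN g : H2_val (- g) = - H2_val g. Proof. by []. Qed.

Lemma H2_valZ (a : C) g : H2_val (a *: g) = a *: H2_val g. Proof. by []. Qed.

Lemma rnorm_H2_val g : rnorm (H2_val g) = rnorm g. Proof. by []. Qed.

(** The defining property of the projection characterizes it, and it is enough to
    test it on the powers of [z]. *)
Lemma H2projE x h : (forall n, L2inner (x - H2_val h) (zpow R n) = 0) ->
  H2proj x = h.
Proof.
move=> xh; apply: xget_unique => [k|k kP]; first exact: L2inner_H2_eq0 xh (valP k).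
apply/val_inj/eqP; rewrite -subr_eq0; apply/eqP/L2inner_eq0.
rewrite {1}(_ : val k - val h = (x - H2_val h) - (x - H2_val k)); last first.
  by rewrite opprB [RHS]addrC addrA subrK.
rewrite L2innerBl -[val k - val h]/(H2_val (k - h)) kP subr0.
exact: L2inner_H2_eq0 xh (valP _).
Qed.

Lemma toeplitz_analytic f g : L2mul f (H2_val g) \in @H2pred R ->
  H2_val (toeplitz f g) = L2mul f (H2_val g).
Proof.
move=> fg; rewrite /toeplitz (@H2projE _ (MkH2 fg))// => n.
by rewrite subrr L2inner0l.
Qed.

Lemma L2mul_zc_H2 x : x \in @H2pred R -> L2mul (@zc R) x \in @H2pred R.
Proof.
apply: (@bounded_linear_H2 _ 1).
- by move=> a u v; rewrite L2mulD ?L2mulZ//; exact: cbounded_zc.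
- by move=> u; apply: rnorm_L2mul_upper; [exact: cbounded_zc|move=> t; rewrite normc_zc].
- by move=> n; rewrite L2mul_zpow zpow_H2.
Qed.

(** The backward shift [x |-> (x - x(0)) / z]. *)
Definition backward_shift x : L2T :=
  L2mul zcJ x - L2inner x (zpow R 0) *: L2mul zcJ (zpow R 0).

Lemma linear_backward_shift : linear backward_shift.
Proof.
move=> a u v; rewrite /backward_shift L2mulD ?L2mulZ; try exact: cbounded_zcJ.
rewrite L2innerDl L2innerZl scalerDl -scalerA scalerBr opprD !addrA.
by congr (_ - _); rewrite addrAC.
Qed.

Lemma backward_shift_H2 x : x \in @H2pred R -> backward_shift x \in @H2pred R.
Proof.
apply: (@bounded_linear_H2 _ 2).
- exact: linear_backward_shift.
- have nJ (u : L2T) : rnorm (L2mul zcJ u) <= rnorm u.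
    rewrite -[leRHS]mul1r; apply: rnorm_L2mul_upper; first exact: cbounded_zcJ.
    by move=> t; rewrite normc_conj normc_zc.
  move=> u; apply: le_trans (rnormB _ _) _;
  rewrite (_ : 2 * rnorm u = rnorm u + rnorm u) ?lerD//; last by rewrite mulr_natl mulr2n.
  rewrite rnormZ (le_trans (ler_wpM2l (normc_ge0 _) (nJ _)))// rnorm_zpow mulr1.
  by apply: le_trans (L2_cauchy_schwarz _ _) _; rewrite rnorm_zpow mulr1.
- case=> [|n]; rewrite /backward_shift zpow_orthonormal.
    by rewrite eqxx scale1r subrr rpred0.
  by rewrite scale0r subr0 L2mul_zcJ_zpow zpow_H2.
Qed.

Lemma zcJ_orthogonal n : L2inner (L2mul zcJ (zpow R 0)) (zpow R n) = 0.
Proof.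
rewrite L2inner_mul; last exact: cbounded_zcJ.
under [X in L2mul X]eq_fun do rewrite conjcK.
by rewrite L2mul_zpow zpow_orthonormal.
Qed.

(** The symbol [Re z = (z + conj z) / 2]. *)
Definition re_z (t : measurableTypeR R) : C := (zc t + (zc t)^*) / 2.

Lemma cbounded_re_z : cbounded re_z.
Proof.
apply: cboundedM; last exact: cbounded_cst.
by apply: cboundedD; [exact: cbounded_zc|exact: cbounded_zcJ].
Qed.

Lemma re_zJ t : (re_z t)^* = re_z t.
Proof. by rewrite /re_z -ReJ_add conjc_real. Qed.

Lemma normc_re_z t : normc (re_z t) <= 1.
Proof.
rewrite /re_z normcM normcV -(rmorph_nat (real_complex R)) normc_real ger0_norm//.
rewrite ler_pdivrMr// mul1r (le_trans (le_normcD _ _))// normc_conj normc_zc.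
by rewrite -[2]/(1 + 1).
Qed.

(** The product with [Re z] is the sum of an element of the Hardy space, for [x] in
    it, and of a multiple of [1 / z], which is orthogonal to it. *)
Lemma L2mul_re_z x : L2mul re_z x =
  2^-1 *: (L2mul (@zc R) x + backward_shift x) +
  (2^-1 * L2inner x (zpow R 0)) *: L2mul zcJ (zpow R 0).
Proof.
rewrite /backward_shift -scalerA -scalerDr addrA subrK.
rewrite -L2mul_add; [|exact: cbounded_zc|exact: cbounded_zcJ].
rewrite -L2mul_cst L2mul_mul; last first.
- by apply: cboundedD; [exact: cbounded_zc|exact: cbounded_zcJ].
- exact: cbounded_cst.
by congr L2mul; apply/funext => t; rewrite /re_z mulrC.
Qed.

Lemma toeplitz_re_zE g : H2_val (toeplitz re_z g) =
  2^-1 *: (L2mul (@zc R) (H2_val g) + backward_shift (H2_val g)).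
Proof.
have TH : 2^-1 *: (L2mul (@zc R) (H2_val g) + backward_shift (H2_val g)) \in @H2pred R.
  by rewrite rpredZ// rpredD ?L2mul_zc_H2 ?backward_shift_H2 ?(valP g).
rewrite /toeplitz (@H2projE _ (MkH2 TH))// => n.
by rewrite L2mul_re_z addrAC subrr add0r L2innerZl zcJ_orthogonal mulr0.
Qed.

Lemma L2inner_toeplitz_re_z g x : x \in @H2pred R ->
  L2inner (H2_val (toeplitz re_z g)) x = L2inner (L2mul re_z (H2_val g)) x.
Proof.
move=> xH; rewrite L2mul_re_z -toeplitz_re_zE L2innerDl L2innerZl.
by rewrite (L2inner_H2_eq0 zcJ_orthogonal xH) mulr0 addr0.
Qed.

End Hardy_space_lemmas.
(** * Inverses and norms of operators *)

Section operator_lemmas.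
Context (R : realType) (V : normedModType R[i]).
Local Notation C := R[i].
Implicit Types (A B : V -> V).

Lemma bounded_below_inverse A (k : R) : linear A -> 0 < k ->
  (forall x, k * rnorm x <= rnorm (A x)) -> (forall y, exists x, A x = y) ->
  exists B, bounded_inverse A B.
Proof.
move=> linA k0 Ak Asurj.
have [B AB] : exists B : V -> V, forall y, A (B y) = y by have [f fE] := boolp.choice Asurj; exists f.
have AB1 x y : A (x - y) = A x - A y by rewrite addrC -scaleN1r linA scaleN1r addrC.
have injA x y : A x = A y -> x = y.
  move=> xy; apply/eqP; rewrite -subr_eq0; apply/eqP/rnorm_eq0/eqP.
  rewrite eq_le rnorm_ge0 andbT -(@ler_pM2l _ k)// mulr0 (le_trans (Ak _))//.
  by rewrite AB1 xy subrr rnorm0.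
exists B; split => //; last by move=> x; apply: injA; rewrite AB.
split; first by move=> a x y; apply: injA; rewrite linA !AB.
by exists k^-1 => x; rewrite -ler_pdivrMl ?invr_gt0// invrK (le_trans (Ak _))// AB.
Qed.

Lemma opinvP A : (exists B, bounded_inverse A B) -> bounded_inverse A (opinv A).
Proof. by move=> [B AB]; apply: (@xgetPex _ (fun=> 0) [set B | bounded_inverse A B]); exists B. Qed.

Lemma linear_comp (f g : V -> V) : linear f -> linear g -> linear (f \o g).
Proof. by move=> lf lg a x y; rewrite /= lg lf. Qed.

Lemma linear_shift_op l A : linear A -> linear (shift_op l A).
Proof.
move=> linA a x y; rewrite /shift_op linA scalerDr opprD scalerBr !scalerA [l * a]mulrC.
by rewrite addrACA.
Qed.

Lemma opnorm_le A (K : R) : 0 <= K -> (forall x, rnorm (A x) <= K * rnorm x) ->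
  (opnorm A <= K%:E)%E.
Proof.
move=> K0 AK; apply: ge_ereal_sup => _ [x /= x1 <-]; rewrite lee_fin.
by rewrite (le_trans (AK x))// ler_piMr.
Qed.

Lemma opnorm_ge A x : linear A -> ((rnorm (A x))%:E <= opnorm A * (rnorm x)%:E)%E.
Proof.
move=> linA; have A0 : A 0 = 0.
  by have := linA (-1) 0 0; rewrite scaler0 addr0 scaleN1r => ->; rewrite addNr.
have [x0|x0] := eqVneq (rnorm x) 0.
  by rewrite (rnorm_eq0 x0) A0 rnorm0 mule0.
have nx : 0 < rnorm x by rewrite lt0r x0 rnorm_ge0.
have AZ (a : C) y : A (a *: y) = a *: A y by rewrite -[a *: y]addr0 linA A0 addr0.
have h : ((rnorm (A ((rnorm x)^-1%:C *: x)))%:E <= opnorm A)%E.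
  apply: ereal_sup_ubound; exists ((rnorm x)^-1%:C *: x) => //=.
  by rewrite rnormZ normc_real ger0_norm ?invr_ge0 ?rnorm_ge0// mulVf.
rewrite -[leLHS]mule1 -(_ : ((rnorm x)^-1 * rnorm x)%:E = 1%E); last by rewrite mulVf.
rewrite EFinM muleA; apply: lee_wpmul2r; first by rewrite lee_fin ltW.
apply: le_trans h; rewrite AZ rnormZ normc_real ger0_norm ?invr_ge0 ?rnorm_ge0//.
by rewrite -EFinM lee_fin mulrC.
Qed.

Lemma opnorm_ge0 A : (0 <= opnorm A)%E.
Proof.
apply: (@le_trans _ _ (rnorm (A 0))%:E); first by rewrite lee_fin rnorm_ge0.
by apply: ereal_sup_ubound; exists 0 => //=; rewrite rnorm0.
Qed.

End operator_lemmas.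

(** * Cauchy kernels and the Wiener-Hopf factorization *)

Section Hardy_resolvents.
Context (R : realType).
Local Notation C := R[i].
Local Notation "z ^*" := (conjc z) : ring_scope.
Local Notation theta := (@theta R).
Local Notation L2T := (L2 theta).
Implicit Types (x y : L2T) (g h : H2 R) (a w : C).

(** The symbol [1 + a z]. *)
Definition one_plus a (t : measurableTypeR R) : C := 1 + a * zc t.

Lemma cbounded_one_plus a : cbounded (one_plus a).
Proof.
apply: cboundedD; first exact: cbounded_cst.
by apply: cboundedM; [exact: cbounded_cst|exact: cbounded_zc].
Qed.

Lemma normc_one_plus_le a t : normc (one_plus a t) <= 1 + normc a.
Proof. by rewrite (le_trans (le_normcD _ _))// normc1 normcM normc_zc mulr1. Qed.

Lemma ler_normcB a w : normc a - normc w <= normc (a + w).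
Proof.
rewrite lerBlDr -[X in normc X <= _](addrK w) (le_trans (le_normcD _ _))//.
by rewrite normcN.
Qed.

Lemma normc_one_plus_ge a t : 1 - normc a <= normc (one_plus a t).
Proof. by have := ler_normcB 1 (a * zc t); rewrite normc1 normcM normc_zc mulr1. Qed.

Lemma L2mul_one_plus a x : L2mul (one_plus a) x = x + a *: L2mul (@zc R) x.
Proof.
rewrite L2mul_add; [|exact: cbounded_cst|]; last first.
  by apply: cboundedM; [exact: cbounded_cst|exact: cbounded_zc].
rewrite L2mul_cst scale1r -L2mul_mul; [|exact: cbounded_cst|exact: cbounded_zc].
by rewrite L2mul_cst.
Qed.

Lemma one_plus_H2 a x : x \in @H2pred R -> L2mul (one_plus a) x \in @H2pred R.
Proof. by move=> xH; rewrite L2mul_one_plus rpredD// rpredZ// L2mul_zc_H2. Qed.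

Lemma L2inner_zc_1 x : x \in @H2pred R -> L2inner (L2mul (@zc R) x) (zpow R 0) = 0.
Proof.
move=> xH; rewrite L2inner_mul; last exact: cbounded_zc.
by rewrite L2innerC (L2inner_H2_eq0 (@zcJ_orthogonal R) xH) conjc0.
Qed.

Section kernel.
Variable a : C.
Hypothesis a1 : normc a < 1.

Lemma one_plus_neq0 t : one_plus a t != 0.
Proof.
apply: contraTneq (normc_one_plus_ge a t) => ->.
by rewrite normc0 -ltNge subr_gt0.
Qed.

Lemma cbounded_one_plusV : cbounded (fun t => (one_plus a t)^-1).
Proof.
apply: (@cboundedV _ _ _ _ (1 - normc a)); first by rewrite subr_gt0.
  exact: cbounded_one_plus.
exact: normc_one_plus_ge.
Qed.

Lemma L2mul_one_plusK x : L2mul (fun t => (one_plus a t)^-1) (L2mul (one_plus a) x) = x.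
Proof.
rewrite L2mul_mul; [|exact: cbounded_one_plusV|exact: cbounded_one_plus].
by under [X in L2mul X]eq_fun do rewrite mulVf ?one_plus_neq0//; rewrite L2mul_cst scale1r.
Qed.

Lemma L2mul_one_plusVK x : L2mul (one_plus a) (L2mul (fun t => (one_plus a t)^-1) x) = x.
Proof.
rewrite L2mul_mul; [|exact: cbounded_one_plus|exact: cbounded_one_plusV].
by under [X in L2mul X]eq_fun do rewrite divff ?one_plus_neq0//; rewrite L2mul_cst scale1r.
Qed.

Lemma rnorm_one_plusV_le x :
  rnorm (L2mul (fun t => (one_plus a t)^-1) x) <= (1 - normc a)^-1 * rnorm x.
Proof.
apply: rnorm_L2mul_upper; first exact: cbounded_one_plusV.
move=> t; rewrite normcV lef_pV2 ?posrE ?subr_gt0 ?normc_one_plus_ge//.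
by rewrite (lt_le_trans _ (normc_one_plus_ge a t))// subr_gt0.
Qed.

(** Division by [1 + a z] preserves the Hardy space: the quotients [z^n / (1 + a z)]
    are approximated by partial sums of their geometric series. *)
Lemma one_plusV_H2 x : x \in @H2pred R ->
  L2mul (fun t => (one_plus a t)^-1) x \in @H2pred R.
Proof.
have cV := cbounded_one_plusV.
apply: (@bounded_linear_H2 _ _ ((1 - normc a)^-1)); last 2 first.
- exact: rnorm_one_plusV_le.
- move=> n; pose s N := \sum_(k < N) (- a) ^+ k *: zpow R (n + k).
  have sE N : L2mul (one_plus a) (s N) = zpow R n - (- a) ^+ N *: zpow R (n + N).
    elim: N => [|N IH].
      rewrite /s big_ord0 expr0 scale1r addn0 subrr.
      by rewrite -(scale0r (0 : L2T)) L2mulZ ?scale0r//; exact: cbounded_one_plus.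
    rewrite /s big_ord_recr L2mulD; last exact: cbounded_one_plus.
    rewrite -/(s N) IH L2mulZ; last exact: cbounded_one_plus.
    rewrite L2mul_one_plus L2mul_zpow scalerDr addrA subrK exprSr scalerA mulrN scaleNr opprK.
    by rewrite addnS.
  apply: H2_closed => e e0.
  have : normc a ^+ k @[k --> \oo] --> (0 : R).
    by apply: cvg_expr; rewrite ger0_norm// normc_ge0.
  have e1 : 0 < e * (1 - normc a) by rewrite mulr_gt0// subr_gt0.
  move=> /cvgrPdist_lt /(_ _ e1) [N _ /(_ N (leqnn N))]; rewrite sub0r normrN => aN.
  exists (s N); first by rewrite rpred_sum// => k _; rewrite rpredZ// zpow_H2.
  have -> : L2mul (fun t => (one_plus a t)^-1) (zpow R n) - s N =
      L2mul (fun t => (one_plus a t)^-1) ((- a) ^+ N *: zpow R (n + N)).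
    rewrite -[s N in LHS]L2mul_one_plusK sE -L2mulB//; congr L2mul.
    by rewrite opprB addrC subrK.
  apply: le_lt_trans (rnorm_one_plusV_le _) _.
  rewrite rnormZ rnorm_zpow mulr1 normcX normcN mulrC ltr_pdivrMr ?subr_gt0//.
  by move: aN; rewrite ger0_norm// exprn_ge0// normc_ge0.
- by move=> c u v; rewrite L2mulD ?L2mulZ.
Qed.

End kernel.

(** For [|w| < 1] the function [1 / (1 - (conj w) z)] represents evaluation at
    [w] on the Hardy space. *)
Definition szego w : L2T := L2mul (fun t => (one_plus (- w^*) t)^-1) (zpow R 0).

Section wiener_hopf.
Variable w : C.
Hypothesis w1 : normc w < 1.

Let wJ1 : normc (- w^*) < 1. Proof. by rewrite normcN normc_conj. Qed.

Lemma szego_H2 : szego w \in @H2pred R.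
Proof. by apply: one_plusV_H2 => //; exact: zpow_H2. Qed.

Lemma szego_eq : szego w = zpow R 0 + w^* *: L2mul (@zc R) (szego w).
Proof.
have := L2mul_one_plusVK wJ1 (zpow R 0); rewrite -/(szego w) L2mul_one_plus.
by move=> {1}<-; rewrite scaleNr subrK.
Qed.

Lemma L2inner_zpow_szego n : L2inner (zpow R n) (szego w) = w ^+ n.
Proof.
elim: n => [|n IH]; rewrite szego_eq L2innerDr L2innerZr conjcK zpow_orthonormal.
  by rewrite L2innerC L2inner_zc_1 ?szego_H2// conjc0 mulr0 addr0.
by rewrite add0r -L2mul_zpow L2inner_zc IH exprS.
Qed.

(** The function [z - w]. *)
Definition zcB (t : measurableTypeR R) : C := zc t - w.

Lemma zcB_ge t : 1 - normc w <= normc (zcB t).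
Proof. by have := ler_normcB (zc t) (- w); rewrite normcN normc_zc. Qed.

Lemma zcB_neq0 t : zcB t != 0.
Proof.
by apply: contraTneq (zcB_ge t) => ->; rewrite normc0 -ltNge subr_gt0.
Qed.

Lemma cbounded_zcB : cbounded zcB.
Proof. by apply: cboundedD; [exact: cbounded_zc|exact: cbounded_cst]. Qed.

Lemma cbounded_zcBV : cbounded (fun t => (zcB t)^-1).
Proof.
apply: (@cboundedV _ _ _ _ (1 - normc w)); first by rewrite subr_gt0.
  exact: cbounded_zcB.
exact: zcB_ge.
Qed.

(** [x |-> (z x - w x(w)) / (z - w)], which is the Toeplitz operator with symbol
    [1 / (1 - w / z)]. *)
Definition coanalytic_inverse x : L2T :=
  L2mul (fun t => (zcB t)^-1)
    (L2mul (@zc R) x - (w * L2inner x (szego w)) *: zpow R 0).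

Lemma coanalytic_inverse_H2 x : x \in @H2pred R ->
  coanalytic_inverse x \in @H2pred R.
Proof.
have cV := cbounded_zcBV.
have cz := cbounded_zc R.
have VB y : rnorm (L2mul (fun t => (zcB t)^-1) y) <= (1 - normc w)^-1 * rnorm y.
  apply: rnorm_L2mul_upper => // t.
  rewrite normcV lef_pV2 ?posrE ?subr_gt0 ?zcB_ge//.
  by rewrite (lt_le_trans _ (zcB_ge t))// subr_gt0.
apply: (@bounded_linear_H2 _ _ ((1 - normc w)^-1 * (1 + rnorm (szego w)))).
- move=> c u v; rewrite /coanalytic_inverse -L2mulZ// -L2mulD//; congr L2mul.
  rewrite L2mulD// L2mulZ// L2innerDl L2innerZl.
  rewrite [w * (_ + _)]mulrDr scalerDl opprD [w * (c * _)]mulrCA.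
  by rewrite -[(c * _) *: _]scalerA [c *: (_ - _)]scalerBr addrACA.
- move=> y; apply: le_trans (VB _) _; rewrite -mulrA ler_wpM2l ?invr_ge0 ?subr_ge0 ?(ltW w1)//.
  apply: le_trans (rnormB _ _) _; rewrite [(1 + _) * _]mulrDl [1 * _]mul1r lerD//.
    rewrite -[leRHS]mul1r; apply: rnorm_L2mul_upper => // t; by rewrite normc_zc.
  rewrite rnormZ rnorm_zpow mulr1 normcM -[leRHS]mul1r.
  apply: ler_pM; [exact: normc_ge0|exact: normc_ge0|exact: ltW|].
  by rewrite [rnorm _ * rnorm _]mulrC L2_cauchy_schwarz.
- move=> n; rewrite /coanalytic_inverse L2inner_zpow_szego L2mul_zpow.
  (* (z^(k+2) - w^(k+2)) / (z - w) = z (z^(k+1) - w^(k+1)) / (z - w) + w^(k+1) *)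
  have one_H2 k : L2mul (fun t => (zcB t)^-1) (zpow R k.+1 - w ^+ k.+1 *: zpow R 0) \in @H2pred R.
    elim: k => [|k IH].
      rewrite (_ : zpow R 1 - _ = L2mul zcB (zpow R 0)); last first.
        by rewrite L2mul_add ?L2mul_cst ?L2mul_zpow ?scaleNr//; exact: cbounded_cst.
      rewrite L2mul_mul//; last exact: cbounded_zcB.
      under [X in L2mul X]eq_fun do rewrite mulVf ?zcB_neq0//.
      by rewrite L2mul_cst scale1r zpow_H2.
    rewrite (_ : zpow R k.+2 - _ = L2mul (@zc R) (zpow R k.+1 - w ^+ k.+1 *: zpow R 0) +
      w ^+ k.+1 *: L2mul zcB (zpow R 0)); last first.
      rewrite L2mulB// L2mulZ// !L2mul_zpow L2mul_add ?L2mul_cst ?L2mul_zpow//; last exact: cbounded_cst.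
      by rewrite scalerDr addrA subrK scalerA mulrN scaleNr -exprSr.
    rewrite L2mulD// rpredD//.
      rewrite L2mul_mul//.
      under [X in L2mul X]eq_fun do rewrite mulrC.
      by rewrite -L2mul_mul// L2mul_zc_H2.
    rewrite L2mulZ// L2mul_mul//; last exact: cbounded_zcB.
    under [X in L2mul X]eq_fun do rewrite mulVf ?zcB_neq0//.
    by rewrite L2mul_cst scale1r rpredZ// zpow_H2.
  by rewrite -exprS one_H2.
Qed.

(** The Wiener-Hopf factorization
    [l - (z + 1 / z) / 2 = (1 - w z) (1 - w / z) / (2 w)] inverts [l - T]
    explicitly when [l] is the image of a point [w] of the punctured open disk
    under the Joukowski map. *)
Lemma shift_toeplitz_surj (f : H2 R) : w != 0 -> exists g,
  shift_op ((w + w^-1) / 2) (toeplitz (@re_z R)) g = f.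
Proof.
move=> w0; set l := (_ / 2).
have w1N : normc (- w) < 1 by rewrite normcN.
pose h := L2mul (fun t => (one_plus (- w) t)^-1) (coanalytic_inverse (H2_val f)).
have hH : (2 * w) *: h \in @H2pred R.
  by rewrite rpredZ// one_plusV_H2// coanalytic_inverse_H2// (valP f).
pose g : H2 R := MkH2 hH.
exists g; rewrite /shift_op; suff -> : toeplitz (@re_z R) g = l *: g - f.
  by rewrite opprB addrC subrK.
have cV := cbounded_one_plusV w1N; have cB := cbounded_zcBV.
have cz := cbounded_zc R; have cJ := cbounded_zcJ R; have cr := cbounded_re_z R.
have cJV : cbounded (fun t => (zc t)^* * zcB t).
  by apply: cboundedM => //; exact: cbounded_zcB.
apply: H2projE => n.
suff -> : L2mul (@re_z R) (H2_val g) - H2_val (l *: g - f) =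
    (w * L2inner (H2_val f) (szego w)) *: L2mul (fun t => (zc t)^*) (zpow R 0).
  by rewrite L2innerZl zcJ_orthogonal mulr0.
rewrite H2_valD H2_valN H2_valZ -[H2_val g]/((2 * w) *: h).
have factor : L2mul (fun t => l + - re_z t) ((2 * w) *: h) =
    L2mul (fun t => (zc t)^* * zcB t) (coanalytic_inverse (H2_val f)).
  rewrite -L2mul_cst L2mul_mul; [| |exact: cbounded_cst]; last first.
    apply: cboundedD; first exact: cbounded_cst.
    under [X in cbounded X]eq_fun do rewrite -mulN1r.
    by apply: cboundedM => //; exact: cbounded_cst.
  rewrite /h L2mul_mul//; last first.
    apply: cboundedM; last exact: cbounded_cst.
    apply: cboundedD; first exact: cbounded_cst.
    under [X in cbounded X]eq_fun do rewrite -mulN1r.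
    by apply: cboundedM => //; exact: cbounded_cst.
  congr L2mul; apply/funext => t; rewrite /l /re_z /zcB.
  have n0 := one_plus_neq0 w1N t; have J1 := @zcJK R t.
  apply: (mulIf n0); rewrite (divfK n0) /one_plus.
  have z0 : zc t != 0 by apply: contra_eq_neq J1 => ->; rewrite mulr0 eq_sym oner_neq0.
  have -> : (zc t)^* = (zc t)^-1 by rewrite -[LHS]mulr1 -(mulfV z0) mulrA J1 mul1r.
  by field; rewrite w0 z0.
have : L2mul (fun t => l + - re_z t) ((2 * w) *: h) = l *: ((2 * w) *: h) - L2mul (@re_z R) ((2 * w) *: h).
  rewrite L2mul_add ?L2mul_cst//; [|exact: cbounded_cst|]; last first.
    under [X in cbounded X]eq_fun do rewrite -mulN1r.
    by apply: cboundedM => //; exact: cbounded_cst.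
  congr (_ + _); rewrite -[RHS]scaleN1r -[RHS]L2mul_cst [RHS]L2mul_mul//; last exact: cbounded_cst.
  by congr L2mul; apply/funext => t; rewrite mulN1r.
rewrite factor => e.
have : L2mul (fun t => (zc t)^* * zcB t) (coanalytic_inverse (H2_val f)) =
    H2_val f - (w * L2inner (H2_val f) (szego w)) *: L2mul (fun t => (zc t)^*) (zpow R 0).
  rewrite /coanalytic_inverse L2mul_mul//.
  under [X in L2mul X]eq_fun do rewrite -mulrA divff ?zcB_neq0// mulr1.
  by rewrite L2mulB// L2mul_zcJK L2mulZ.
rewrite e => {}e.
have -> : (w * L2inner (H2_val f) (szego w)) *: L2mul (fun t => (zc t)^*) (zpow R 0) =
  H2_val f - (l *: ((2 * w) *: h) - L2mul (@re_z R) ((2 * w) *: h)) by rewrite e opprB addrC subrK.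
by rewrite !opprB addrC -addrA; congr (_ + _); rewrite addrC.
Qed.

End wiener_hopf.
End Hardy_resolvents.
(** * The spectrum of the Toeplitz operator with symbol Re z *)

Section segment.
Context (R : realType).
Local Notation C := R[i].
Local Notation "z ^*" := (conjc z) : ring_scope.
Implicit Types (l w : C) (m : R).

(** The real segment [-1, 1] in the complex plane. *)
Definition segment : set C := [set l | exists2 m : R, -1 <= m <= 1 & l = m%:C].

Lemma normc_realB_ge l : l \notin segment -> exists2 k : R, 0 < k &
  forall m, -1 <= m <= 1 -> k <= normc (l - m%:C).
Proof.
move=> /negP; rewrite inE => lS.
have [il|il] := eqVneq (complex.Im l) 0; last first.
  exists `|complex.Im l|; first by rewrite normr_gt0.
  move=> n _; apply: le_trans (ler_normIm _).
  by rewrite ImD /= oppr0 addr0.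
have lE : l = (complex.Re l)%:C by move: il; case: (l) => x y /= ->.
have l1 : 1 < `|complex.Re l|.
  rewrite ltNge; apply/negP => l1; apply: lS; exists (complex.Re l) => //.
  by rewrite -ler_norml.
exists (`|complex.Re l| - 1); first by rewrite subr_gt0.
move=> n; rewrite -ler_norml => n1; rewrite lE -rmorphB normc_real.
apply: le_trans (lerB_dist _ _); exact: lerB.
Qed.

(** The roots [w] and [1 / w] of [w^2 - 2 l w + 1] are conjugate when they lie on the
    unit circle, in which case [l] is in the segment. *)
Lemma joukowski_preimage l : l \notin segment ->
  exists w, [/\ w != 0, normc w < 1 & l = (w + w^-1) / 2].
Proof.
move=> /negP; rewrite inE => lS.
pose r := sqrtc (l ^+ 2 - 1).
have r2 : r ^+ 2 = l ^+ 2 - 1 by exact: sqr_sqrtc.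
have pm : (l + r) * (l - r) = 1 by rewrite mulrC -subr_sqr r2 opprB addrC subrK.
have n1 : normc (l + r) * normc (l - r) = 1 by rewrite -normcM pm normc1.
have p0 : l + r != 0.
  by apply: contra_eq_neq pm => ->; rewrite mul0r eq_sym oner_neq0.
have m0 : l - r != 0.
  by apply: contra_eq_neq pm => ->; rewrite mulr0 eq_sym oner_neq0.
have pV : (l + r)^-1 = l - r by rewrite -[LHS]mulr1 -pm mulKf.
have mV : (l - r)^-1 = l + r by rewrite -pV invrK.
have n2 : (2 : C) != 0 by rewrite pnatr_eq0.
have [lt1|gt1|eq1] := ltgtP (normc (l + r)) 1.
- exists (l + r); split => //; rewrite pV addrACA subrr addr0.
  by rewrite -mulr2n -(mulr_natr l 2) mulfK.
- exists (l - r); split => //.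
    rewrite ltNge; apply/negP => h; suff : 1 < 1 :> R by rewrite ltxx.
    rewrite -[ltRHS]n1 (lt_le_trans gt1)// -[leLHS]mulr1 ler_wpM2l//.
    exact: normc_ge0.
  by rewrite mV addrACA addNr addr0 -mulr2n -(mulr_natr l 2) mulfK.
- exfalso; apply: lS; exists (complex.Re (l + r)).
    by rewrite -ler_norml (le_trans (ler_normRe _))// eq1.
  have J : (l + r)^* = l - r.
    by apply: (mulfI p0); rewrite pm normc_mulJ eq1 expr1n.
  rewrite ReJ_add J addrACA subrr addr0.
  by rewrite -mulr2n -(mulr_natr l 2) mulfK.
Qed.

End segment.

Section free_jacobi.
Context (R : realType).
Local Notation C := R[i].
Local Notation "z ^*" := (conjc z) : ring_scope.
Local Notation theta := (@theta R).
Local Notation L2T := (L2 theta).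
Local Notation T := (toeplitz (@re_z R)).
Implicit Types (x y : L2T) (g h : H2 R) (l : C).

Lemma linear_toeplitz_re_z : linear T.
Proof.
pose F x := 2^-1 *: (L2mul (@zc R) x + backward_shift x).
have linF : linear F.
  move=> a x y; rewrite /F linear_backward_shift L2mulD ?L2mulZ; try exact: cbounded_zc.
  by rewrite addrACA -scalerDr [2^-1 *: (_ + _)]scalerDr !scalerA [2^-1 * a]mulrC.
move=> a g h; apply/val_inj; apply: (etrans (toeplitz_re_zE _)).
apply: (etrans (linF a (H2_val g) (H2_val h))).
by congr (_ *: _ + _); apply/esym; exact: toeplitz_re_zE.
Qed.

Lemma rnorm_L2mul_re_z x : rnorm (L2mul (@re_z R) x) <= rnorm x.
Proof.
rewrite -[leRHS]mul1r; apply: rnorm_L2mul_upper; first exact: cbounded_re_z.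
exact: normc_re_z.
Qed.

Lemma rnorm_toeplitz_re_z g : rnorm (T g) <= rnorm g.
Proof.
have [->|/eqP Tg0] := eqVneq (T g) 0; first by rewrite rnorm0 rnorm_ge0.
have Tg : 0 < rnorm (T g) by rewrite lt0r rnorm_ge0 andbT; apply/eqP => /rnorm_eq0.
rewrite -(@ler_pM2r _ (rnorm (T g)))//.
have -> : rnorm (T g) * rnorm (T g) = normc (L2inner (H2_val (T g)) (H2_val (T g))).
  by rewrite L2inner_self normc_real ger0_norm ?sqr_ge0// rnorm_H2_val expr2.
rewrite L2inner_toeplitz_re_z ?(valP (T g))//.
apply: le_trans (L2_cauchy_schwarz _ _) _; rewrite -!rnorm_H2_val ler_wpM2r ?rnorm_ge0//.
exact: rnorm_L2mul_re_z.
Qed.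

(** The numerical range of the selfadjoint contraction [T] lies in [-1, 1]. *)
Lemma numerical_range g : exists2 m : R, -1 <= m <= 1 &
  L2inner (H2_val (T g)) (H2_val g) = (m * rnorm g ^+ 2)%:C.
Proof.
have [->|/eqP g0] := eqVneq g 0.
  exists 0; first by rewrite lerN10 ler01.
  by rewrite -[H2_val 0]/0 L2inner0r mul0r.
have ng : 0 < rnorm g by rewrite lt0r rnorm_ge0 andbT; apply/eqP => /rnorm_eq0.
set c := L2inner _ _; have cJ : c^* = c.
  rewrite /c L2inner_toeplitz_re_z ?(valP g)// -L2innerC.
  rewrite L2inner_mul; last exact: cbounded_re_z.
  by under [X in _ = L2inner _ (L2mul X _)]eq_fun do rewrite re_zJ.
have cR : c = (complex.Re c)%:C.
  have := congr1 (@complex.Im R) cJ; rewrite ImJ; case: (c) => x y /= yN.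
  by have -> : y = 0 by lra.
exists (complex.Re c / rnorm g ^+ 2); last by rewrite divfK ?sqrf_eq0 ?gt_eqF.
rewrite -ler_norml normrM normfV [`|_ ^+ 2|]ger0_norm ?sqr_ge0//.
rewrite ler_pdivrMr ?exprn_gt0// mul1r -normc_real -cR.
apply: le_trans (L2_cauchy_schwarz _ _) _; rewrite !rnorm_H2_val expr2.
by rewrite ler_wpM2r ?rnorm_ge0// rnorm_toeplitz_re_z.
Qed.

Lemma shift_toeplitz_lower l g : exists2 m : R, -1 <= m <= 1 &
  normc (l - m%:C) * rnorm g <= rnorm (shift_op l T g).
Proof.
have [m m1 Tg] := numerical_range g; exists m => //.
have [->|/eqP g0] := eqVneq g 0; first by rewrite rnorm0 mulr0 rnorm_ge0.
have ng : 0 < rnorm g by rewrite lt0r rnorm_ge0 andbT; apply/eqP => /rnorm_eq0.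
rewrite -(@ler_pM2r _ (rnorm g))//.
apply: le_trans (L2_cauchy_schwarz (H2_val (shift_op l T g)) (H2_val g)).
rewrite /shift_op H2_valD H2_valN H2_valZ L2innerBl L2innerZl Tg L2inner_self rnorm_H2_val.
have -> : l * (rnorm g ^+ 2)%:C - (m * rnorm g ^+ 2)%:C = (l - m%:C) * (rnorm g ^+ 2)%:C.
  by rewrite (rmorphM (real_complex R) m) mulrBl.
by rewrite normcM normc_real ger0_norm ?sqr_ge0// expr2 mulrA.
Qed.

Lemma shift_toeplitz_inverse l : l \notin @segment R ->
  exists B, bounded_inverse (shift_op l T) B.
Proof.
move=> lS; have [k k0 kl] := normc_realB_ge lS.
apply: (bounded_below_inverse (k := k)) => //.
- exact: linear_shift_op linear_toeplitz_re_z.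
- move=> g; have [m m1] := shift_toeplitz_lower l g; apply: le_trans.
  by rewrite ler_wpM2r ?rnorm_ge0// kl.
- have [w [w0 w1 ->]] := joukowski_preimage lS.
  by move=> f; exact: shift_toeplitz_surj.
Qed.

(** The constant function 1 as an element of the Hardy space. *)
Definition H2_one : H2 R := MkH2 (zpow_H2 R 0).

(** The Fourier coefficients of a solution of [(m - T) g = 1] satisfy the recurrence
    of the Chebyshev polynomials; they would have constant nonzero modulus if
    they tended to 0. *)
Lemma segment_not_surjective (m : R) g : -1 <= m <= 1 ->
  shift_op m%:C T g <> H2_one.
Proof.
move=> /andP[m1 m2] gE.
pose c k := L2inner (H2_val g) (zpow R k).
have rec k : m%:C * c k - L2inner (H2_val g) (L2mul (@re_z R) (zpow R k)) = (k == 0)%:R.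
  have := congr1 (fun h => L2inner (H2_val h) (zpow R k)) gE.
  rewrite /shift_op H2_valD H2_valN H2_valZ L2innerBl L2innerZl zpow_orthonormal.
  rewrite L2inner_toeplitz_re_z ?zpow_H2// L2inner_mul; last exact: cbounded_re_z.
  under [X in L2inner _ (L2mul X _)]eq_fun do rewrite re_zJ.
  by rewrite eq_sym.
have gJ : L2inner (H2_val g) (L2mul (fun t => (zc t)^*) (zpow R 0)) = 0.
  by rewrite L2innerC (L2inner_H2_eq0 (@zcJ_orthogonal R) (valP g)) conjc0.
have half : (2^-1)^* = 2^-1 :> C.
  by rewrite conjc_inv; congr (_ ^-1); rewrite -[2](@mulr1n C 2) conjc_nat.
have rec0 : c 1 = 2 * m%:C * c 0 - 2.
  have := rec 0%N; rewrite L2mul_re_z /backward_shift zpow_orthonormal eqxx scale1r subrr addr0.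
  rewrite L2innerDr !L2innerZr gJ mulr0 addr0 half L2mul_zpow -/(c 1) => e.
  have -> : c 1 = 2 * (m%:C * c 0) - 2 * (m%:C * c 0 - 2^-1 * c 1) by field.
  by rewrite e mulr1 mulrA.
have recS k : c k.+2 = 2 * m%:C * c k.+1 - c k.
  have := rec k.+1; rewrite L2mul_re_z /backward_shift zpow_orthonormal scale0r subr0 mulr0 scale0r addr0.
  rewrite L2innerZr L2innerDr half L2mul_zpow L2mul_zcJ_zpow -/(c k) -/(c k.+2) => e.
  have -> : c k.+2 = 2 * (m%:C * c k.+1) - c k - 2 * (m%:C * c k.+1 - 2^-1 * (c k.+2 + c k)) by field.
  by rewrite e mulr0 subr0 mulrA.
(* the characteristic root of the recurrence c (k+2) = 2 m c (k+1) - c k, of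
   modulus 1; the sequence extends backwards by the value 2 *)
pose w : C := m +i* Num.sqrt (1 - m ^+ 2).
have m21 : 0 <= 1 - m ^+ 2.
  have -> : 1 - m ^+ 2 = (1 - m) * (1 + m) by ring.
  by rewrite mulr_ge0 ?subr_ge0// -lerBlDl sub0r.
have nw : normc w = 1 by rewrite Defs.normcE/= sqr_sqrtr// addrCA subrr addr0 sqrtr1.
have wJ : w * w^* = 1 by rewrite normc_mulJ nw expr1n.
have w2 : w + w^* = 2 * m%:C by rewrite addcJ.
have h1 k : c k.+1 - w * c k = w^* ^+ k.+1 * (c 0 - 2 * w).
  elim: k => [|k IH].
    by rewrite rec0 -w2 expr1 mulrBr [_ * (2 * w)]mulrCA [w^* * w]mulrC wJ mulr1; ring.
  rewrite exprS -mulrA -IH recS -w2 mulrBr [w^* * (w * _)]mulrA [w^* * w]mulrC wJ mul1r.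
  by ring.
have c0 : c 0 = 2 * w.
  apply/eqP; rewrite -subr_eq0; apply/eqP/eq0_normc/eqP.
  rewrite eq_le normc_ge0 andbT; apply/ler_addgt0Pr => e e0; rewrite add0r.
  have [|N cN] := @H2_coef_to0 _ (H2_val g) (e / 2) (valP g); first by rewrite divr_gt0.
  have -> : normc (c 0 - 2 * w) = normc (c N.+1 - w * c N).
    by rewrite h1 normcM normcX normc_conj nw expr1n mul1r.
  apply: le_trans (le_normcD _ _) _; rewrite normcN normcM nw mul1r [leRHS]splitr.
  by apply/ltW/ltrD; exact: cN.
have cn k : normc (c k) = 2.
  elim: k => [|k IH]; first by rewrite c0 normcM nw mulr1 -(rmorph_nat (real_complex R)) normc_real ger0_norm.
  have := h1 k; rewrite c0 subrr mulr0 => /eqP; rewrite subr_eq0 => /eqP ->.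
  by rewrite normcM nw mul1r.
have [|N cN] := @H2_coef_to0 _ (H2_val g) 1 (valP g); first by [].
by have := cN N (leqnn N); rewrite -/(c N) cn ltNge ler1n.
Qed.

End free_jacobi.
(** * The similar operator *)

Section similarity.
Context (R : realType).
Local Notation C := R[i].
Local Notation "z ^*" := (conjc z) : ring_scope.
Local Notation theta := (@theta R).
Local Notation L2T := (L2 theta).
Local Notation T := (toeplitz (@re_z R)).
Implicit Types (x y : L2T) (g h : H2 R) (l : C).
Variable beta : C.
Hypothesis beta1 : normc beta < 1.
Local Notation b := (normc beta).
Local Notation S := (toeplitz (one_plus beta)).
Local Notation Si := (opinv S).
Local Notation A := (Si \o T \o S).

Let b0 : 0 <= b := normc_ge0 beta.
Let mb0 : 0 < 1 - b. Proof. by rewrite subr_gt0. Qed.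

Lemma toeplitz_one_plusE g : H2_val (S g) = L2mul (one_plus beta) (H2_val g).
Proof. by apply: toeplitz_analytic; apply: one_plus_H2; exact: (valP g). Qed.

Lemma linear_toeplitz_one_plus : linear S.
Proof.
have cS := cbounded_one_plus beta.
move=> a g h; apply/val_inj; apply: (etrans (toeplitz_one_plusE _)).
apply: (etrans (L2mulD (a *: H2_val g) (H2_val h) cS)).
rewrite (L2mulZ a (H2_val g) cS).
by congr (_ *: _ + _); apply/esym; exact: toeplitz_one_plusE.
Qed.

Lemma toeplitz_one_plus_upper g : rnorm (S g) <= (1 + b) * rnorm g.
Proof.
rewrite -rnorm_H2_val (toeplitz_one_plusE g).
by apply: rnorm_L2mul_upper; [exact: cbounded_one_plus|exact: normc_one_plus_le].
Qed.

Lemma toeplitz_one_plus_lower g : (1 - b) * rnorm g <= rnorm (S g).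
Proof.
rewrite -(rnorm_H2_val (S g)) (toeplitz_one_plusE g).
by apply: rnorm_L2mul_lower; [exact: ltW|exact: cbounded_one_plus|exact: normc_one_plus_ge].
Qed.

Lemma toeplitz_one_plus_inverse : exists B, bounded_inverse S B.
Proof.
apply: (bounded_below_inverse linear_toeplitz_one_plus mb0 toeplitz_one_plus_lower) => f.
have gH := one_plusV_H2 beta1 (valP f).
exists (MkH2 gH); apply/val_inj; apply: (etrans (toeplitz_one_plusE _)).
exact: L2mul_one_plusVK.
Qed.

Lemma toeplitz_one_plusK : cancel S Si.
Proof. by have [] := opinvP toeplitz_one_plus_inverse. Qed.

Lemma toeplitz_one_plusVK : cancel Si S.
Proof. by have [] := opinvP toeplitz_one_plus_inverse. Qed.

Lemma linear_opinv_one_plus : linear Si.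
Proof. by have [[]] := opinvP toeplitz_one_plus_inverse. Qed.

Lemma opinv_one_plus_upper g : rnorm (Si g) <= (1 - b)^-1 * rnorm g.
Proof.
rewrite -ler_pdivrMl ?invr_gt0// invrK.
by rewrite (le_trans (toeplitz_one_plus_lower _))// toeplitz_one_plusVK.
Qed.

Lemma linear_similar : linear A.
Proof.
apply: linear_comp linear_toeplitz_one_plus.
exact: linear_comp linear_opinv_one_plus (@linear_toeplitz_re_z R).
Qed.

Lemma similarE n g : iter n A g = Si (iter n T (S g)).
Proof.
elim: n => [|n IH]; first by rewrite /= toeplitz_one_plusK.
by rewrite iterS IH /= toeplitz_one_plusVK.
Qed.

Lemma rnorm_iter_similar n g : rnorm (iter n A g) <= (1 + b) / (1 - b) * rnorm g.
Proof.
rewrite similarE; apply: le_trans (opinv_one_plus_upper _) _.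
rewrite [(1 + b) / _]mulrC -mulrA ler_wpM2l ?invr_ge0 ?(ltW mb0)//.
apply: le_trans (toeplitz_one_plus_upper _).
elim: n => [|n IH]; first exact: lexx.
rewrite iterS; exact: le_trans (rnorm_toeplitz_re_z _) IH.
Qed.

Lemma rnorm_similar g : rnorm (A g) <= (1 + b) / (1 - b) * rnorm g.
Proof. exact: (rnorm_iter_similar 1 g). Qed.

Lemma bounded_similar : bounded_operator A.
Proof. by split; [exact: linear_similar|exists ((1 + b) / (1 - b)); exact: rnorm_similar]. Qed.

Lemma toeplitz_shift_similar l g : S (shift_op l A g) = shift_op l T (S g).
Proof.
rewrite /shift_op -scaleN1r addrC linear_toeplitz_one_plus scaleN1r /=.
rewrite toeplitz_one_plusVK addrC; congr (_ - _).
have S0 : S 0 = 0.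
  by have := linear_toeplitz_one_plus (-1) 0 0; rewrite scaler0 addr0 scaleN1r => ->; rewrite addNr.
by rewrite -[l *: g]addr0 linear_toeplitz_one_plus S0 addr0.
Qed.

(** This inclusion of spectra comes from [S (l - A) = (l - T) S]. *)
Lemma shift_similar_inverse l : l \notin @segment R ->
  exists B, bounded_inverse (shift_op l A) B.
Proof.
move=> lS; have [k k0 kl] := normc_realB_ge lS.
apply: (bounded_below_inverse (k := k * (1 - b) / (1 + b))).
- exact: linear_shift_op linear_similar.
- by rewrite divr_gt0 ?mulr_gt0// ltr_pwDl.
- move=> g; rewrite -(@ler_pM2l _ (1 + b)) ?ltr_pwDl//.
  apply: le_trans (toeplitz_one_plus_upper _).
  rewrite toeplitz_shift_similar mulrA [(1 + b) * _]mulrC divfK ?gt_eqF ?ltr_pwDl//.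
  rewrite -mulrA; apply: (@le_trans _ _ (k * rnorm (S g))).
    by rewrite ler_wpM2l ?(ltW k0)// toeplitz_one_plus_lower.
  have [m m1] := shift_toeplitz_lower l (S g); apply: le_trans.
  by rewrite ler_wpM2r ?rnorm_ge0// kl.
- move=> f; have [B [_ _ BK]] := shift_toeplitz_inverse lS.
  exists (Si (B (S f))); apply: (can_inj toeplitz_one_plusK).
  by rewrite toeplitz_shift_similar toeplitz_one_plusVK BK.
Qed.

(** The operators [A] and [T] are similar and have the same spectrum, the segment
    [-1, 1]. *)
Lemma spectrum_similar : spectrum A = @segment R.
Proof.
apply/seteqP; split => l.
  move=> nB; apply: contrapT => lS; apply: nB; apply: shift_similar_inverse.
  by rewrite notin_setE.
move=> [m m1 ->] [B [_ _ BK]].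
apply: (@segment_not_surjective _ m (S (B (Si (@H2_one R)))) m1).
by rewrite -toeplitz_shift_similar BK toeplitz_one_plusVK.
Qed.

End similarity.
(** * Scalar inequalities *)

Section power_lower_bounds.
Context (R : realType).
Local Notation C := R[i].
Local Notation "z ^*" := (conjc z) : ring_scope.
Variable beta : C.
Hypothesis beta1 : normc beta < 1.
Local Notation s := (1 - normc beta ^+ 2).

(** The norm of [A 1], in closed form; see [rnorm_similar_one]. *)
Definition norm_A1 : R := Num.sqrt ((1 - 2 * s * complex.Re (beta ^+ 2)) / (4 * s)).

Lemma defect_gt0 : 0 < s.
Proof. by rewrite subr_gt0 exprn_ilt1// normc_ge0. Qed.

Lemma ler_sqrt_sqr (a c : R) : 0 <= a -> a ^+ 2 <= c -> a <= Num.sqrt c.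
Proof.
move=> a0 ac; have c0 : 0 <= c by rewrite (le_trans _ ac)// sqr_ge0.
by rewrite -(@ler_pXn2r _ 2)// ?nnegrE ?sqrtr_ge0// sqr_sqrtr.
Qed.

Lemma first_lower_bound :
  normc (beta - beta^* * s%:C) / (2 * Num.sqrt s) <= norm_A1.
Proof.
have s0 := defect_gt0; have ss : Num.sqrt s ^+ 2 = s by rewrite sqr_sqrtr// ltW.
apply: ler_sqrt_sqr; first by rewrite divr_ge0 ?normc_ge0// mulr_ge0// sqrtr_ge0.
pose x := complex.Re beta; pose y := complex.Im beta.
have sE : s = 1 - (x ^+ 2 + y ^+ 2) by rewrite sqr_normc_ReIm.
have nE (t : R) : normc (beta - beta^* * t%:C) ^+ 2 =
    x ^+ 2 * (1 - t) ^+ 2 + y ^+ 2 * (1 + t) ^+ 2.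
  by rewrite sqr_normc_ReIm /x /y; case: (beta) => u v /=; ring.
have uE : complex.Re (beta ^+ 2) = x ^+ 2 - y ^+ 2.
  by rewrite /x /y; case: (beta).
rewrite exprMn exprVn exprMn ss (_ : 2 ^+ 2 = 4); last by ring.
rewrite nE uE ler_pM2r ?invr_gt0 ?mulr_gt0//.
move: s0 sE; generalize (1 - normc beta ^+ 2) => t t0 tE.
have e : x ^+ 2 + y ^+ 2 = 1 - t by rewrite tE; ring.
have t1 : t <= 1 by rewrite -subr_ge0 -e addr_ge0// sqr_ge0.
rewrite -subr_ge0; set lhs := (X in 0 <= X).
have -> : lhs = 1 - (x ^+ 2 + y ^+ 2) * (1 + t ^+ 2) by rewrite /lhs; ring.
by rewrite e; nra.
Qed.

(** The second quantity equals [|2 + beta^2| |1 - s beta| / (8 sqrt s)], with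
    [s = 1 - |beta|^2].  In terms of [p = s (1 - s)], the square of its numerator
    is at most [(3 + 2 p)^2 - 8 (Im beta)^2]; for [s > 9/50] this is less than
    [64 s], so that the quantity is at most 1, and for smaller [s] it is less than
    [16 (1 - 2 s Re (beta^2))], so that the quantity is at most [norm_A1]. *)
Lemma second_lower_bound :
  Num.sqrt s / 8 * normc ((2 + beta^* ^+ 2) / s%:C - 2 * beta^* - beta^* ^+ 3) <=
  Num.max 1 norm_A1.
Proof.
have s0 := defect_gt0; have ss : Num.sqrt s ^+ 2 = s by rewrite sqr_sqrtr// ltW.
set a := _ * normc _.
have a0 : 0 <= a by rewrite mulr_ge0 ?normc_ge0// divr_ge0// sqrtr_ge0.
pose N := (2 + beta^* ^+ 2) * (1 - s%:C * beta^*).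
have aE : a ^+ 2 = normc N ^+ 2 / (64 * s).
  have sC : s%:C != 0 :> C by rewrite (inj_eq (@complexI R) _ 0) gt_eqF.
  have -> : a = Num.sqrt s / 8 * (normc N / s).
    have eN : (2 + beta^* ^+ 2) / s%:C - 2 * beta^* - beta^* ^+ 3 = N / s%:C.
      by rewrite /N; move: sC; generalize s%:C => c c0; field.
    by rewrite /a eN normcM normcV normc_real gtr0_norm.
  by rewrite !exprMn ss; field; rewrite gt_eqF.
pose x := complex.Re beta; pose y := complex.Im beta.
have sE : s = 1 - (x ^+ 2 + y ^+ 2) by rewrite sqr_normc_ReIm.
have NE : normc N ^+ 2 = ((2 + (x ^+ 2 - y ^+ 2)) ^+ 2 + 4 * x ^+ 2 * y ^+ 2) *
    ((1 - s * x) ^+ 2 + s ^+ 2 * y ^+ 2).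
  rewrite normcM exprMn !sqr_normc_ReIm /x /y; case: (beta) => u v /=.
  by congr (_ * _); ring.
have uE : complex.Re (beta ^+ 2) = x ^+ 2 - y ^+ 2.
  by rewrite /x /y; case: (beta).
have key : normc N ^+ 2 <= 64 * s \/
    normc N ^+ 2 <= 16 * (1 - 2 * s * (x ^+ 2 - y ^+ 2)).
  rewrite NE; move: s0 sE; generalize (1 - normc beta ^+ 2) => t t0 tE.
  set n1 := (X in X * _); set n2 := (X in _ * X).
  have t1 : t <= 1 by rewrite tE lerBlDr lerDl addr_ge0// sqr_ge0.
  pose p := t * (1 - t).
  have p0 : 0 <= p by rewrite mulr_ge0 ?(ltW t0)// subr_ge0.
  (* a bound on |1 - t beta|^2, as - 2 Re beta <= 1 + |beta|^2 = 2 - t *)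
  pose m2 := (1 + t * (2 - t) / 2) ^+ 2.
  have n2m2 : n2 <= m2.
    rewrite -subr_ge0.
    have -> : m2 - n2 = t * ((1 + x) ^+ 2 + y ^+ 2) + t ^+ 4 / 4 +
        (t * (2 - t) - t * (1 + x ^+ 2 + y ^+ 2)) +
        t ^+ 2 * (1 - t - (x ^+ 2 + y ^+ 2)) by rewrite /m2 /n2; field.
    have -> : 1 + x ^+ 2 + y ^+ 2 = 2 - t by rewrite tE; ring.
    have -> : x ^+ 2 + y ^+ 2 = 1 - t by rewrite tE; ring.
    rewrite !subrr mulr0 !addr0 addr_ge0//.
      by rewrite mulr_ge0 ?(ltW t0)// addr_ge0// sqr_ge0.
    by rewrite divr_ge0// exprn_ge0// ltW.
  have m20 : 0 <= m2 by exact: sqr_ge0.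
  have n1E : n1 = (3 - t) ^+ 2 - 8 * y ^+ 2 by rewrite /n1 tE; ring.
  have y20 : 0 <= y ^+ 2 by exact: sqr_ge0.
  have n10 : 0 <= n1 by rewrite /n1 addr_ge0 ?sqr_ge0// mulr_ge0 ?sqr_ge0// mulr_ge0// sqr_ge0.
  have gp : (3 - t) ^+ 2 * m2 <= (3 + 2 * p) ^+ 2.
    rewrite /m2 -exprMn.
    have g0 : 0 <= (3 - t) * (1 + t * (2 - t) / 2) by apply: mulr_ge0; nra.
    apply: lerXn2r; rewrite ?nnegrE//; first by rewrite addr_ge0// mulr_ge0.
    have -> : (3 - t) * (1 + t * (2 - t) / 2) = 3 + 2 * p - t ^+ 2 * (1 - t) / 2.
      by rewrite /p; field.
    by rewrite gerBl divr_ge0// mulr_ge0 ?sqr_ge0// subr_ge0.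
  have nn : n1 * n2 <= (3 + 2 * p) ^+ 2 - 8 * y ^+ 2.
    apply: (@le_trans _ _ (n1 * m2)); first by rewrite ler_wpM2l.
    have m21 : 1 <= m2.
      rewrite /m2 exprn_ege1// lerDl divr_ge0// mulr_ge0 ?(ltW t0)//.
      by rewrite subr_ge0 (le_trans t1)// ler1n.
    rewrite n1E mulrBl lerB// -[leLHS]mulr1 ler_wpM2l// mulr_ge0//.
  have [t18|t18] := leP t (9 / 50).
    right; apply: le_trans nn _.
    have p1 : p <= 9 / 50 * (41 / 50) by rewrite /p; nra.
    have -> : x ^+ 2 - y ^+ 2 = 1 - t - 2 * y ^+ 2 by rewrite tE; ring.
    have -> : 16 * (1 - 2 * t * (1 - t - 2 * y ^+ 2)) = 16 - 32 * p + 64 * (t * y ^+ 2).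
      by rewrite /p; ring.
    have ty : 0 <= t * y ^+ 2 by rewrite mulr_ge0// ltW.
    have pp : p * p <= p * (9 / 50 * (41 / 50)) by rewrite ler_wpM2l.
    have -> : (3 + 2 * p) ^+ 2 = 9 + 12 * p + 4 * (p * p) by ring.
    by lra.
  left; apply: le_trans nn _; apply: (@le_trans _ _ ((3 + 2 * p) ^+ 2)).
    by rewrite gerBl mulr_ge0.
  have p4 : p <= 1 / 4 by have := sqr_ge0 (t - 1 / 2); rewrite /p; lra.
  have [t5|t5] := leP t (1 / 2); last first.
    have pp : p * p <= p * (1 / 4) by rewrite ler_wpM2l.
    have -> : (3 + 2 * p) ^+ 2 = 9 + 12 * p + 4 * (p * p) by ring.
    by lra.
  have pt : p <= t * (41 / 50) by rewrite /p ler_wpM2l ?(ltW t0)//; lra.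
  apply: (@le_trans _ _ ((3 + 2 * (t * (41 / 50))) ^+ 2)).
    by apply: lerXn2r; rewrite ?nnegrE ?addr_ge0 ?mulr_ge0 ?(ltW t0)//; lra.
  have tt : 0 <= (t - 9 / 50) * (1 / 2 - t) by apply: mulr_ge0; lra.
  by lra.
rewrite le_max; case: key => h; apply/orP.
  left; rewrite -(@ler_pXn2r _ 2)// ?nnegrE// expr1n aE ler_pdivrMr ?mulr_gt0//.
  by rewrite mul1r.
right; apply: ler_sqrt_sqr => //; rewrite aE uE.
have -> : (1 - 2 * s * (x ^+ 2 - y ^+ 2)) / (4 * s) =
  16 * (1 - 2 * s * (x ^+ 2 - y ^+ 2)) / (64 * s) by field; rewrite gt_eqF.
by rewrite ler_wpM2r// invr_ge0 mulr_ge0// ltW.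
Qed.

End power_lower_bounds.
(** * Bounds on powers and resolvents *)

Section power_and_resolvent_bounds.
Context (R : realType).
Local Notation C := R[i].
Local Notation "z ^*" := (conjc z) : ring_scope.
Local Notation theta := (@theta R).
Local Notation L2T := (L2 theta).
Local Notation T := (toeplitz (@re_z R)).
Implicit Types (x y : L2T) (g h : H2 R) (l : C).
Variable beta : C.
Hypothesis beta1 : normc beta < 1.
Local Notation b := (normc beta).
Local Notation S := (toeplitz (one_plus beta)).
Local Notation Si := (opinv S).
Local Notation A := (Si \o T \o S).
Local Notation s := (1 - b ^+ 2).
Local Notation K := ((1 + b) / (1 - b)).

Let K0 : 0 <= K.
Proof.
by apply: divr_ge0; [rewrite addr_ge0 ?normc_ge0|rewrite subr_ge0 ltW].
Qed.

Let k := szego (- beta^*).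

Let w1 : normc (- beta^*) < 1. Proof. by rewrite normcN normc_conj. Qed.

Lemma szego_betaE : k = L2mul (fun t => (one_plus beta t)^-1) (zpow R 0).
Proof. by rewrite /k /szego raddfN/= conjcK opprK. Qed.

Lemma rnorm_szego_sqr : rnorm k ^+ 2 = s^-1.
Proof.
have s0 := defect_gt0 beta1.
have := congr1 (fun x => rnorm x ^+ 2) (szego_eq w1); rewrite -/k rnormD_sqr.
rewrite L2innerZr L2innerC L2inner_zc_1 ?szego_H2// conjc0 mulr0 mulr0 addr0.
rewrite rnorm_zpow expr1n rnormZ exprMn normc_conj normcN normc_conj.
have -> : rnorm (L2mul (@zc R) k) ^+ 2 = rnorm k ^+ 2.
  by apply: complexI; rewrite -!L2inner_self L2inner_zc.
have s00 : s != 0 by rewrite gt_eqF.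
move=> e; apply: (mulfI s00); rewrite divff//.
by rewrite mulrBl [1 * _]mul1r {1}e addrK.
Qed.

(** [A 1 = z / 2 + (beta / 2) k] where [k = 1 / (1 + beta z)]. *)
Lemma similar_one : H2_val (A (@H2_one R)) = 2^-1 *: zpow R 1 + (beta / 2) *: k.
Proof.
have gH : 2^-1 *: zpow R 1 + (beta / 2) *: k \in @H2pred R.
  by rewrite rpredD// rpredZ ?zpow_H2 ?szego_H2.
suff e : S (MkH2 gH) = T (S (@H2_one R)).
  by rewrite /= -e toeplitz_one_plusK.
have cS := cbounded_one_plus beta; have cz := cbounded_zc R.
apply/val_inj; apply: (etrans (toeplitz_one_plusE beta _)).
apply/esym; apply: (etrans (toeplitz_re_zE _)).
rewrite (toeplitz_one_plusE beta (@H2_one R)) -[H2_val (@H2_one R)]/(zpow R 0).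
rewrite -[H2_val (MkH2 gH)]/(2^-1 *: zpow R 1 + (beta / 2) *: k).
rewrite (L2mulD _ _ cS) !(L2mulZ _ _ cS) szego_betaE (L2mul_one_plusVK beta1).
rewrite !L2mul_one_plus !L2mul_zpow.
have bs0 : backward_shift (zpow R 0) = 0.
  by rewrite /backward_shift zpow_orthonormal eqxx scale1r subrr.
have bs1 : backward_shift (zpow R 1) = zpow R 0.
  by rewrite /backward_shift zpow_orthonormal scale0r subr0 L2mul_zcJ_zpow.
rewrite [zpow R 0 + _]addrC linear_backward_shift bs0 bs1 addr0.
rewrite (L2mulD _ _ cz) (L2mulZ _ _ cz) !L2mul_zpow.
rewrite [beta *: zpow R 2 + _]addrC scalerDr !scalerA.
by rewrite [2^-1 * beta]mulrC.
Qed.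

Lemma rnorm_similar_one : rnorm (A (@H2_one R)) = norm_A1 beta.
Proof.
have s0 := defect_gt0 beta1.
rewrite -[LHS](ger0_norm (rnorm_ge0 _)) -sqrtr_sqr; congr Num.sqrt.
rewrite -rnorm_H2_val similar_one rnormD_sqr !rnormZ rnorm_zpow !exprMn expr1n rnorm_szego_sqr.
have half : normc (2^-1 : C) = 2^-1.
  by rewrite normcV -(rmorph_nat (real_complex R)) normc_real ger0_norm.
have half2 : 2^-1 = (2^-1)%:C :> C by rewrite fmorphV/= rmorph_nat.
rewrite L2innerZl L2innerZr L2inner_zpow_szego// expr1 normcM half.
have -> : 2^-1 * ((beta / 2)^* * - beta^*) = (- 4^-1)%:C * (beta ^+ 2)^*.
  rewrite half2; case: (beta) => u v; apply/eqP.
  by rewrite eq_complex /=; apply/andP; split; apply/eqP; field.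
have -> : complex.Re ((- 4^-1)%:C * (beta ^+ 2)^*) = - 4^-1 * complex.Re (beta ^+ 2).
  by rewrite Defs.ReM ReJ /= mul0r subr0.
rewrite exprMn; set v := complex.Re _.
have s00 : s != 0 by rewrite gt_eqF.
move: s00; by generalize b => c c0; field; exact: c0.
Qed.

Lemma power_bound_le : (power_bound A <= K%:E)%E.
Proof.
apply: ge_ereal_sup => _ [n _ <-]; apply: opnorm_le => // g.
exact: rnorm_iter_similar.
Qed.

Lemma rnorm_H2_one : rnorm (@H2_one R) = 1. Proof. exact: rnorm_zpow. Qed.

Lemma power_bound_ge n : ((rnorm (iter n A (@H2_one R)))%:E <= power_bound A)%E.
Proof.
apply: (@le_trans _ _ (opnorm (iter n A))); last first.
  by apply: ereal_sup_ubound; exists n.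
by apply: ereal_sup_ubound; exists (@H2_one R) => //=; rewrite rnorm_H2_one.
Qed.

Lemma power_bound_lower : ((Num.max 1 (norm_A1 beta))%:E <= power_bound A)%E.
Proof.
have h0 := power_bound_ge 0; have h1 := power_bound_ge 1.
rewrite /= in h0; rewrite rnorm_H2_one in h0; rewrite rnorm_similar_one in h1.
by case: (leP 1 (norm_A1 beta)).
Qed.

Let resolventP l : 1 < normc l ->
  bounded_inverse (shift_op l A) (opinv (shift_op l A)).
Proof.
move=> l1; apply: opinvP; apply: shift_similar_inverse => //.
rewrite notin_setE => -[m]; rewrite -ler_norml => m1 e; move: l1.
by rewrite e normc_real ltNge m1.
Qed.

Lemma dist_to_spectrum l : exists2 d : R, 0 <= d & dist_to l (spectrum A) = d%:E.
Proof.
have d0 : (0 <= dist_to l (spectrum A))%E.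
  by apply: le_ereal_inf_tmp => _ [m _ <-]; rewrite lee_fin normc_ge0.
have dl : (dist_to l (spectrum A) <= (normc l)%:E)%E.
  apply: ereal_inf_lbound; exists 0; last by rewrite subr0.
  by rewrite spectrum_similar//; exists 0; rewrite ?lerN10 ?ler01.
have df : dist_to l (spectrum A) \is a fin_num.
  by rewrite ge0_fin_numE// (le_lt_trans dl)// ltry.
by exists (fine (dist_to l (spectrum A))); rewrite ?fine_ge0// fineK.
Qed.

Lemma dist_to_le l (m : R) : -1 <= m <= 1 ->
  (dist_to l (spectrum A) <= (normc (l - m%:C))%:E)%E.
Proof.
move=> m1; apply: ereal_inf_lbound; exists m%:C => //.
by rewrite spectrum_similar//; exists m.
Qed.

Lemma resolvent_bound_le : (resolvent_bound A <= K%:E)%E.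
Proof.
apply: ge_ereal_sup => _ [l /= l1 <-].
have [d d0 dE] := dist_to_spectrum l; rewrite dE.
have [_ _ BK] := resolventP l1; set B := opinv _ in BK *.
have [->|dn0] := eqVneq d 0; first by rewrite mul0e lee_fin.
have d1 : 0 < d by rewrite lt0r dn0.
have mb0 : 0 < 1 - b by rewrite subr_gt0.
apply: (@le_trans _ _ (d%:E * (K / d)%:E)%E); last first.
  by rewrite -EFinM lee_fin mulrC divfK.
apply: lee_wpmul2l; first by rewrite lee_fin.
apply: opnorm_le; first by rewrite divr_ge0.
move=> g; rewrite mulrAC ler_pdivlMr//.
rewrite -(@ler_pM2l _ (1 - b))// mulrA [(1 - b) * (_ * _)]mulrA [(1 - b) * K]mulrC.
rewrite divfK ?gt_eqF//; apply: le_trans (toeplitz_one_plus_upper _ _).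
rewrite -{2}(BK g) toeplitz_shift_similar//.
have [m m1] := shift_toeplitz_lower l (S (B g)); apply: le_trans.
have dm : d <= normc (l - m%:C) by rewrite -lee_fin -dE dist_to_le.
rewrite [X in X <= _]mulrC; apply: ler_pM => //; first by rewrite mulr_ge0 ?rnorm_ge0// ltW.
exact: toeplitz_one_plus_lower.
Qed.

Lemma resolvent_bound_fin : exists2 p : R, 0 <= p & resolvent_bound A = p%:E.
Proof.
pose l : C := 2; have l2 : 1 < normc l.
  by rewrite /l -(rmorph_nat (real_complex R)) normc_real ger0_norm// ltr1n.
have P0 : (0 <= resolvent_bound A)%E.
  have ub : (dist_to l (spectrum A) * opnorm (opinv (shift_op l A)) <= resolvent_bound A)%E.
    by apply: ereal_sup_ubound; exists l.
  apply: le_trans ub; have [d d0 ->] := dist_to_spectrum l.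
  by rewrite mule_ge0 ?lee_fin// opnorm_ge0.
have Pf : resolvent_bound A \is a fin_num.
  by rewrite ge0_fin_numE// (le_lt_trans resolvent_bound_le)// ltry.
by exists (fine (resolvent_bound A)); rewrite ?fine_ge0// fineK.
Qed.

(** Any lower bound [d] for the distance from [l] to the segment can replace the
    distance itself. *)
Lemma resolvent_bound_ge l g (p d : R) : 1 < normc l -> resolvent_bound A = p%:E ->
  0 <= d -> (forall m : R, -1 <= m <= 1 -> d <= normc (l - m%:C)) ->
  d * rnorm (opinv (shift_op l A) g) <= p * rnorm g.
Proof.
move=> l1 pE d0 dm; have [[linB _] _ _] := resolventP l1; set B := opinv _ in linB *.
rewrite -lee_fin 2!EFinM -pE.
apply: (@le_trans _ _ (dist_to l (spectrum A) * (opnorm B * (rnorm g)%:E))%E).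
  apply: lee_pmul; rewrite ?lee_fin ?rnorm_ge0 ?opnorm_ge//.
  apply: le_ereal_inf_tmp => _ [m mA <-]; rewrite lee_fin.
  by move: mA; rewrite spectrum_similar// => -[m' m1 ->]; exact: dm.
rewrite muleA; apply: lee_wpmul2r; first by rewrite lee_fin rnorm_ge0.
by apply: ereal_sup_ubound; exists l.
Qed.

Lemma resolvent_bound_ge1 : (1 <= resolvent_bound A)%E.
Proof.
have [p p0 pE] := resolvent_bound_fin; rewrite pE lee_fin leNgt; apply/negP => p1.
(* at l = r the distance is at least r - 1 and the norm of the resolvent at
   least 1 / (r + K), a product that tends to 1 as r grows *)
have key (r : R) : 1 < r -> r - 1 <= p * (r + K).
  move=> r1; have nr : normc (r%:C : C) = r.
    by rewrite normc_real gtr0_norm// (lt_trans _ r1).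
  have l1 : 1 < normc (r%:C : C) by rewrite nr.
  have [_ BK _] := resolventP l1.
  have := @resolvent_bound_ge _ (shift_op r%:C A (@H2_one R)) p (r - 1) l1 pE.
  rewrite BK rnorm_H2_one mulr1 => h.
  apply: (le_trans (h _ _)).
  - by rewrite subr_ge0 ltW.
  - move=> m /andP[_ m1]; rewrite -rmorphB normc_real (le_trans _ (ler_norm _))//.
    by rewrite lerB.
  - rewrite ler_wpM2l// (le_trans (rnormB _ _))// rnormZ nr rnorm_H2_one mulr1 lerD2l//.
    by have := rnorm_similar beta1 (@H2_one R); rewrite rnorm_H2_one mulr1.
have p1' : 0 < 1 - p by rewrite subr_gt0.
pose r := 2 + (1 + p * K) / (1 - p).
have h0 : 0 <= (1 + p * K) / (1 - p) by rewrite divr_ge0 ?(ltW p1')// addr_ge0// mulr_ge0.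
have /key : 1 < r by rewrite /r; lra.
have e : (1 + p * K) / (1 - p) * (1 - p) = 1 + p * K by rewrite divfK// gt_eqF.
by move: e h0; rewrite /r; set q := _ / (1 - p); nra.
Qed.

(** The inverse square of the distance from [l] to the segment is at most
    [|l - 1|^-2 + |l + 1|^-2].  With [u = Re l] and [a = |l|^2] the difference of
    the two sides, cleared of denominators, is
    [(2 u - m (a + 1))^2 + (a^2 - 1) (1 - m^2)]. *)
Lemma dist_segment_sqr l (m : R) : 1 < normc l -> -1 <= m <= 1 ->
  1 <= normc (l - m%:C) ^+ 2 * invsq_dist_pm1 l.
Proof.
move=> l1 /andP[m1 m2]; have a1 : 1 < normc l ^+ 2 by rewrite exprn_egt1.
have m21 : 0 <= 1 - m ^+ 2.
  have -> : 1 - m ^+ 2 = (1 - m) * (1 + m) by ring.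
  by rewrite mulr_ge0 ?subr_ge0// -lerBlDl sub0r.
rewrite /invsq_dist_pm1 mulrA.
have n0 : 0 < normc (l ^+ 2 - 1) ^+ 2.
  rewrite exprn_gt0// lt0r normc_ge0 andbT; apply/eqP => /eq0_normc/eqP.
  by rewrite subr_eq0 => /eqP e; move: a1; rewrite -normcX e normc1 ltxx.
rewrite ler_pdivlMr// mul1r; move: a1; rewrite !sqr_normc_ReIm; case: (l) => u v /=.
set a := u ^+ 2 + v ^+ 2 => a1; rewrite -subr_ge0; set d := (X in 0 <= X).
have -> : d = (2 * u - m * (a + 1)) ^+ 2 + (a ^+ 2 - 1) * (1 - m ^+ 2).
  by rewrite /d /a; ring.
by rewrite addr_ge0 ?sqr_ge0// mulr_ge0// subr_ge0 ltW// exprn_egt1.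
Qed.

Lemma power_le_resolvent (p : R) n g : 0 <= p -> resolvent_bound A = p%:E ->
  rnorm (iter n A g) <= 2 * expR 1 * p ^+ 2 * rnorm g.
Proof.
move=> p0 pE; apply: (power_le_resolvent_sqr K0 p0).
- exact: linear_similar.
- exact: rnorm_iter_similar.
move=> l l1; have [_ BK _] := resolventP l1.
exists (opinv (shift_op l A)); split => // h.
set q := invsq_dist_pm1 l.
have q0 : 0 < q.
  have m0 : (-1 : R) <= 0 <= (1 : R) by rewrite lerN10 ler01.
  have := dist_segment_sqr (m := 0) l1 m0; rewrite -/q => /(lt_le_trans ltr01).
  by rewrite pmulr_rgt0// exprn_gt0// subr0 (lt_trans _ l1).
have sq : 0 < Num.sqrt q by rewrite sqrtr_gt0.
rewrite mulrAC -ler_pdivrMr// mulrC.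
apply: resolvent_bound_ge => //.
move=> m m1; rewrite -(@ler_pXn2r _ 2)// ?nnegrE ?normc_ge0 ?invr_ge0 ?(ltW sq)//.
rewrite exprVn sqr_sqrtr ?(ltW q0)// -[leLHS]mul1r ler_pdivrMr//.
exact: dist_segment_sqr.
Qed.

Lemma sqrt_power_le_resolvent :
  (sqrte (((2 * expR 1)^-1)%:E * power_bound A) <= resolvent_bound A)%E.
Proof.
have [p p0 pE] := resolvent_bound_fin.
have e0 : 0 < 2 * expR 1 :> R by rewrite mulr_gt0// expR_gt0.
have Mp : (power_bound A <= (2 * expR 1 * p ^+ 2)%:E)%E.
  apply: ge_ereal_sup => _ [n _ <-]; apply: opnorm_le.
    by rewrite mulr_ge0 ?(ltW e0)// sqr_ge0.
  by move=> g; exact: power_le_resolvent.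
rewrite pE; apply: (@le_trans _ _ (sqrte (p ^+ 2)%:E)).
  rewrite lee_sqrt ?lee_fin ?sqr_ge0//.
  apply: (@le_trans _ _ (((2 * expR 1)^-1)%:E * (2 * expR 1 * p ^+ 2)%:E)%E).
    by apply: lee_wpmul2l => //; rewrite lee_fin invr_ge0 ltW.
  by rewrite -EFinM mulKf ?gt_eqF.
by rewrite /sqrte sqrtr_sqr ger0_norm.
Qed.

End power_and_resolvent_bounds.

Theorem theorem3p3 (R : realType) (beta : R[i])
    (beta_gt0 : 0 < normc beta) (beta_lt1 : normc beta < 1) :
  let S := toeplitz (fun t => 1 + beta * zc t) in
  let A := opinv S \o toeplitz (fun t => (zc t + (zc t)^*) / 2) \o S in
  let b := normc beta in
  [/\ (exists B, bounded_inverse S B),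
      bounded_operator A &
      spectrum A `<=` [set l | normc l <= 1]] /\
  ((Num.max
      (normc (beta - beta^* * (1 - b ^+ 2)%:C) / (2 * Num.sqrt (1 - b ^+ 2)))
      (Num.sqrt (1 - b ^+ 2) / 8 *
        normc ((2 + beta^* ^+ 2) / (1 - b ^+ 2)%:C - 2 * beta^* - beta^* ^+ 3))
    )%:E <= power_bound A <= ((1 + b) / (1 - b))%:E)%E /\
  (Order.max 1 (sqrte (((2 * expR 1)^-1)%:E * power_bound A))
    <= resolvent_bound A <= ((1 + b) / (1 - b))%:E)%E.
Proof.
move=> S A b.
have SE : S = toeplitz (one_plus beta) by [].
have AE : A = opinv (toeplitz (one_plus beta)) \o toeplitz (@re_z R) \o
  toeplitz (one_plus beta) by [].
have inv := toeplitz_one_plus_inverse beta_lt1.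
have bdd := bounded_similar beta_lt1; have sp := spectrum_similar beta_lt1.
have pl := power_bound_lower beta_lt1; have pu := power_bound_le beta_lt1.
have ru := resolvent_bound_le beta_lt1; have r1 := resolvent_bound_ge1 beta_lt1.
have rs := sqrt_power_le_resolvent beta_lt1.
rewrite -AE in bdd sp pl pu ru r1 rs.
split; last split.
- split => //; rewrite sp => _ [m m1 ->].
  suff : normc m%:C <= 1 by [].
  by rewrite normc_real ler_norml.
- apply/andP; split => //; apply: le_trans pl; rewrite lee_fin ge_max; apply/andP; split.
    rewrite le_max; apply/orP; right; exact: first_lower_bound.
  exact: second_lower_bound.
- apply/andP; split => //; rewrite ge_max r1; exact: rs.
Qed.
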